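(* Let $S>0$. There exists $\alpha_0=\alpha_0(S)<0$ such that, for every boundary parameter $\alpha\in[\alpha_0,0)$, the equilateral triangle is a strict local maximiser of the lowest Robin eigenvalue in the family of triangles of area $S$. Moreover, for the fixed area $S$ and any $\alpha\in[\alpha_0,0)$ there exist a sufficiently small $\varepsilon>0$ and a constant $C>0$ such that $$\lambda_{a,c}\le\lambda_0-C\left(a^2+(c-c_0)^2\right)$$ provided that $|a|+|c-c_0|<\varepsilon$.
   Context: For a bounded Lipschitz domain $\Omega\subset\mathbb{R}^2$ and $\alpha\in\mathbb{R}$, the lowest Robin eigenvalue is $$\lambda_1^\alpha(\Omega)=\inf_{u\in H^1(\Omega),\,u\neq0}\frac{\int_\Omega|\nabla u|^2+\alpha\int_{\partial\Omega}|u|^2}{\int_\Omega|u|^2},$$ with the boundary integral understood in the sense of traces. Fix $S>0$. For $a\in\mathbb{R}$ and $c>0$, $\Omega_{a,c}$ denotes the (open) triangle with vertices $(-c,0)$, $(c,0)$ and $(a,S/c)$; it has area $S$, and every triangle of area $S$ is congruent to some $\Omega_{a,c}$. Put $a_0:=0$ and $c_0:=\sqrt{S/\sqrt3}$; then $\Omega_0:=\Omega_{a_0,c_0}$ is the equilateral triangle of area $S$. Write $\lambda_{a,c}:=\lambda_1^\alpha(\Omega_{a,c})$ and $\lambda_0:=\lambda_1^\alpha(\Omega_0)$. ''Strict local maximiser in the family of triangles of area $S$'' means that there is a neighbourhood of $(0,c_0)$ in $\mathbb{R}\times(0,\infty)$ such that $\lambda_{a,c}<\lambda_0$ for all $(a,c)\neq(0,c_0)$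 in this neighbourhood. *)

(* Defs.v *)
From HB Require Import structures.
From mathcomp Require Import all_boot all_order all_algebra.
From mathcomp Require Import all_classical all_reals all_analysis.

Set Implicit Arguments.
Unset Strict Implicit.
Unset Printing Implicit Defensive.

Import Order.TTheory GRing.Theory Num.Theory.
Import numFieldNormedType.Exports.

Local Open Scope classical_set_scope.
Local Open Scope ring_scope.

Section Robin.
Context {R : realType}.

Local Notation plane := (R * R)%type.
Local Notation leb := (@lebesgue_measure R).

Local Notation mplane := (measurableTypeR R * measurableTypeR R)%type.

Definition leb2 : {measure set mplane -> \bar R} := (leb \x leb)%E.

Definition e1 : plane := (1, 0).
Definition e2 : plane := (0, 1).

(* f is C^(n+1) iff it is differentiable everywhere and all its directional
   derivatives are C^n *)
Fixpoint is_Ck (n : nat) (f : plane -> R) : Prop :=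
  if n is m.+1 then
    (forall p, differentiable f p) /\ (forall v, is_Ck m ('D_v f))
  else continuous f.

Definition smooth (f : plane -> R) : Prop := forall n, is_Ck n f.

Definition test_function (Omega : set plane) (phi : plane -> R) : Prop :=
  smooth phi /\
  exists K, [/\ compact K, K `<=` Omega & forall p, ~ K p -> phi p = 0].

Definition sqnorm (Omega : set plane) (f : plane -> R) : \bar R :=
  (\int[leb2]_(p in Omega) (f p ^+ 2)%:E)%E.

Definition L2 (Omega : set plane) (f : plane -> R) : Prop :=
  measurable_fun Omega f /\ (sqnorm Omega f < +oo)%E.

Definition weak_derivative (Omega : set plane) (v : plane)
    (u g : plane -> R) : Prop :=
  forall phi, test_function Omega phi ->
    \int[leb2]_(p in Omega) (u p * 'D_v phi p) =
    - \int[leb2]_(p in Omega) (g p * phi p).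

(* u is (a representative of) an element of H^1(Omega) and (gx, gy) is (a
   representative of) its weak gradient, which is unique up to null sets *)
Definition H1 (Omega : set plane) (u gx gy : plane -> R) : Prop :=
  [/\ L2 Omega u, L2 Omega gx, L2 Omega gy,
      weak_derivative Omega e1 u gx & weak_derivative Omega e2 u gy].

(* The boundary of a polygon is given by its edges (A, B); arc length on the
   edge is the Euclidean length times the uniform measure of the affine
   parametrisation (the norm of the library on R * R is the maximum norm). *)
Definition edge_length (e : plane * plane) : R :=
  Num.sqrt ((e.2.1 - e.1.1) ^+ 2 + (e.2.2 - e.1.2) ^+ 2).

Definition edge_point (e : plane * plane) (s : R) : plane :=
  e.1 + s *: (e.2 - e.1).

Definition bd_sqnorm (Gamma : seq (plane * plane)) (f : plane -> R) : \bar R :=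
  (\sum_(e <- Gamma) (edge_length e)%:E *
     \int[leb]_(s in `[0%R, 1%R]) (f (edge_point e s) ^+ 2)%:E)%E.

Definition bd_L2 (Gamma : seq (plane * plane)) (f : plane -> R) : Prop :=
  (forall e, e \in Gamma ->
     measurable_fun (`[0, 1] : set R) (fun s : R => f (edge_point e s))) /\
  (bd_sqnorm Gamma f < +oo)%E.

(* t is the trace of u: the trace operator is the continuous extension to
   H^1(Omega) of the restriction to the boundary of functions smooth up to the
   boundary (which are dense, Omega being Lipschitz).  Only the values of t on
   the boundary matter. *)
Definition is_trace (Omega : set plane) (Gamma : seq (plane * plane))
    (u gx gy t : plane -> R) : Prop :=
  bd_L2 Gamma t /\
  exists phi : nat -> plane -> R,
    [/\ forall n, smooth (phi n),
        sqnorm Omega (fun p => phi n p - u p) @[n --> \oo] --> 0%E,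
        sqnorm Omega (fun p => 'D_e1 (phi n) p - gx p) @[n --> \oo] --> 0%E,
        sqnorm Omega (fun p => 'D_e2 (phi n) p - gy p) @[n --> \oo] --> 0%E &
        bd_sqnorm Gamma (fun p => phi n p - t p) @[n --> \oo] --> 0%E].

Definition robin_quotient (alpha : R) (Omega : set plane)
    (Gamma : seq (plane * plane)) (u gx gy t : plane -> R) : R :=
  (fine (sqnorm Omega gx) + fine (sqnorm Omega gy)
     + alpha * fine (bd_sqnorm Gamma t)) / fine (sqnorm Omega u).

(* The infimum is taken in the extended reals, so that it is the true infimum
   without any boundedness precondition. *)
Definition robin_eigenvalue (alpha : R) (Omega : set plane)
    (Gamma : seq (plane * plane)) : \bar R :=
  ereal_inf [set q | exists u gx gy t : plane -> R,
    [/\ H1 Omega u gx gy,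
        ~ {ae leb2, forall p, Omega p -> u p = 0},
        is_trace Omega Gamma u gx gy t &
        q = (robin_quotient alpha Omega Gamma u gx gy t)%:E]].

(* open triangle with (non-collinear) vertices A, B, C *)
Definition triangle (A B C : plane) : set plane :=
  [set p | exists x y z : R,
    [/\ 0 < x, 0 < y, 0 < z, x + y + z = 1 &
        p = x *: A + y *: B + z *: C]].

Definition triangle_edges (A B C : plane) : seq (plane * plane) :=
  [:: (A, B); (B, C); (C, A)].

Definition lambda_tri (S alpha a c : R) : \bar R :=
  let A := (- c, 0) in let B := (c, 0) in let C := (a, S / c) in
  robin_eigenvalue alpha (triangle A B C) (triangle_edges A B C).

Definition c0 (S : R) : R := Num.sqrt (S / Num.sqrt 3).

Definition strict_local_maximiser (S alpha : R) : Prop :=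
  \forall p \near ((0, c0 S) : plane),
    0 < p.2 -> p <> (0, c0 S) ->
    (lambda_tri S alpha p.1 p.2 < lambda_tri S alpha 0 (c0 S))%E.

End Robin.

(* Main.v *)
Require Import Defs.
From HB Require Import structures.
From mathcomp Require Import all_boot all_order all_algebra.
From mathcomp Require Import all_classical all_reals all_analysis.
From mathcomp Require Import measurable_realfun ring lra.
Set Implicit Arguments.
Unset Strict Implicit.
Unset Printing Implicit Defensive.
Import Order.TTheory GRing.Theory Num.Theory.
Import numFieldNormedType.Exports.
Local Open Scope classical_set_scope.
Local Open Scope ring_scope.

(** Why the theorem holds.  A function on the equilateral triangle T0 can be
    carried to a nearby triangle T of the same area by the affine map matching
    their vertices, and there are three orientation-preserving ways to match
    them.  Average the Robin energies of the three transplanted functions.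
    These maps have Jacobian 1, so the L2 norm does not change; the Dirichlet
    integral is multiplied by the ratio of the sums of the squared side
    lengths, and the boundary integral by the ratio of the perimeters
    [energy_sum].  This holds for every smooth function, and one of the three
    transplants is at least as good as the mean [lambda_tri_le_avg].

    Write h = a^2 + (c - c0)^2 and beta = - alpha.  The Dirichlet factor exceeds
    1 by O(h) [sum_lengths_sqr_le], while the perimeter factor exceeds 1 by at
    least a multiple of h [perimeter_ge], because the equilateral triangle is
    the strict, nondegenerate minimiser of the perimeter at given area.  The
    boundary term has the sign of alpha < 0, so the change of the energy is at
    most O(h) |grad u|^2 - const * beta * h * (boundary mass of u), and it
    remains to see that |grad u|^2 is small compared with beta |u|^2.

    This is true of every u whose quotient on T0 is at most beta^2 above that of
    the constant function.  The divergence theorem gives a trace inequality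
    whose leading constant is perimeter over area [side_int_BC_le]; it is an
    equality for constants, so that the terms of order beta cancel and
    |grad u|^2 = O(beta^2) |u|^2 remains [gradient_small], which the gain of order
    beta beats for small beta [energy_gain].

    Only smooth functions have to be considered.  A competitor on T0 comes with
    a trace, hence with smooth approximations whose quotients converge to its
    own [smooth_approx_quotient]; conversely a smooth function is an admissible
    competitor on T [lambda_tri_le].  All integrals are computed on the
    reference triangle with vertices (0,0), (1,0), (0,1) in barycentric
    coordinates, where rematching the vertices is the affine map [vcycle]. *)

Local Notation leb := lebesgue_measure.

(** * Measurability and affine substitution *)

Section Borel.
Context {R : realType}.
Implicit Types (p q r s e : R) (f : R * R -> R).
Local Notation mplane := (measurableTypeR R * measurableTypeR R)%type.

(** The boxes with rational endpoints form a countable base of the product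
    topology and lie in the product sigma-algebra. *)
Lemma open_plane_measurable (U : set (R * R)) :
  open U -> measurable (U : set mplane).
Proof.
move=> oU.
pose box (q : rat * rat * (rat * rat)) : set (R * R) :=
  `]ratr q.1.1, ratr q.1.2[%classic `*` `]ratr q.2.1, ratr q.2.2[%classic.
have -> : U = \bigcup_(q in [set q | box q `<=` U]) box q.
  apply/seteqP; split=> [[x y] Uxy|z [q /= qU /qU //]].
  have /nbhs_ballP[e /= e0 eU] : nbhs (x, y) U by exact: open_nbhs_nbhs.
  have ltl t : t - e < t by rewrite gtrBl.
  have ltr t : t < t + e by rewrite ltrDl.
  have [a1 /[!in_itv]/= /andP[xa1 a1x]] := rat_in_itvoo (ltl x).
  have [b1 /[!in_itv]/= /andP[xb1 b1x]] := rat_in_itvoo (ltr x).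
  have [a2 /[!in_itv]/= /andP[ya2 a2y]] := rat_in_itvoo (ltl y).
  have [b2 /[!in_itv]/= /andP[yb2 b2y]] := rat_in_itvoo (ltr y).
  exists ((a1, b1), (a2, b2)); last by split => /=; rewrite in_itv/=; apply/andP.
  move=> [u v] [/= /[!in_itv]/= /andP[? ?] /andP[? ?]]; apply: eU.
  by split; rewrite /ball/= ltr_distlC; lra.
rewrite bigcup_mkcond; apply: countable_bigcupT_measurable => // q.
case: ifPn => // _.
by apply: measurableX; exact: measurable_itv.
Qed.

Lemma continuous_plane_measurable f :
  continuous f -> measurable_fun [set: mplane] f.
Proof.
move=> cf; apply: (measurability _ (measurable_realfun.RGenOpens.measurableE R)).
move=> _ [_ [a [b ->] <-]]; rewrite setTI; apply: open_plane_measurable.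
by move/continuousP : cf; apply; exact: interval_open.
Qed.

(** Lebesgue measure is determined by its values on half-open intervals, where
    the image measure scaled by |p| agrees with it. *)
Lemma ge0_integral_affine p e (f : R -> \bar R) : p != 0 ->
  measurable_fun setT f -> (forall x, 0 <= f x)%E ->
  (\int[leb]_x f (p * x + e)%R = `|p|^-1%:E * \int[leb]_x f x)%E.
Proof.
move=> p0 mf f0.
pose phi := (fun x => p * x + e) : measurableTypeR R -> measurableTypeR R.
have mphi : measurable_fun setT phi.
  apply: continuous_measurable_fun => x.
  by apply: continuousD; [apply: continuousM;
    [exact: cvg_cst|exact: cvg_id]|exact: cvg_cst].
(* Arbitrary kinds of endpoints occur because a negative [p] exchanges the
   open and the closed end. *)
have preim (b1 b2 : bool) (a b : R) :
  phi @^-1` [set` Interval (BSide b1 a) (BSide b2 b)] =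
    if 0 < p then [set` Interval (BSide b1 ((a - e) / p)) (BSide b2 ((b - e) / p))]
    else [set` Interval (BSide (~~ b2) ((b - e) / p)) (BSide (~~ b1) ((a - e) / p))].
  have [pge|ple|/eqP] := ltgtP p 0; last by rewrite (negPf p0).
    apply/seteqP; split => x /=; rewrite !in_itv/= /phi;
    case: b1; case: b2; rewrite /= ?ler_ndivrMr ?ltr_ndivrMr ?ler_ndivlMr
      ?ltr_ndivlMr// => /andP[? ?]; apply/andP; lra.
  apply/seteqP; split => x /=; rewrite !in_itv/= /phi;
    case: b1; case: b2; rewrite /= ?ler_pdivrMr ?ltr_pdivrMr ?ler_pdivlMr
      ?ltr_pdivlMr// => /andP[? ?]; apply/andP; lra.
have muE A : measurable A -> leb A = (`|p|%:E * pushforward leb phi A)%E.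
  pose k : {nonneg R} := NngNum (normr_ge0 p).
  apply: (@lebesgue_measure_unique R (mscale k (pushforward leb phi))) =>
    //= _ [[a b]] _ <-.
  rewrite /mscale/= /pushforward/= preim; case: ltP => hp.
    rewrite !lebesgue_measure_itv/= !lte_fin !gtr0_norm//.
    rewrite ltr_pM2r ?invr_gt0// ltrD2r; case: ifP => _; last by rewrite mule0.
    by rewrite -!EFinB -EFinM; congr (_%:E); field.
  have hp' : p < 0 by rewrite lt_neqAle p0.
  rewrite !lebesgue_measure_itv/= !lte_fin !ltr0_norm//.
  rewrite ltr_nM2r ?invr_lt0// ltrD2r; case: ifP => _; last by rewrite mule0.
  by rewrite -!EFinB -EFinM; congr (_%:E); field.
transitivity (\int[pushforward leb phi]_x f x)%E.
  by rewrite ge0_integral_pushforward.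
pose k : {nonneg R} := NngNum (normr_ge0 p^-1).
rewrite -normfV -(@ge0_integral_mscale _ _ _ leb _ _ k)//.
apply: eq_measure_integral => //= A mA _.
rewrite /mscale/= muE// muleA -EFinM -normrM mulVf// normr1 mul1e//.
Qed.
End Borel.

Section ChangeOfVariables.
Context {R : realType}.
Implicit Types (p q r s e : R).
Local Notation mplane := (measurableTypeR R * measurableTypeR R)%type.

Lemma continuous_affine_form (a b c : R) :
  continuous (fun z : R * R => a * z.1 + b * z.2 + c).
Proof.
move=> z; apply: cvgD; last exact: cvg_cst.
apply: cvgD; apply: cvgM;
  [exact: cvg_cst | exact: cvg_fst | exact: cvg_cst | exact: cvg_snd].
Qed.

Lemma measurable_upper_affine p q r e s :
  measurable_fun [set: mplane]
    (fun z => (p * z.1 + (q * z.2 + e), r * z.2 + s) : mplane).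
Proof.
apply/measurable_fun_pairP; split; apply: continuous_plane_measurable => z.
  have -> : fst \o (fun z : R * R =>
    (p * z.1 + (q * z.2 + e), r * z.2 + s)) = (fun z => p * z.1 + q * z.2 + e).
    by apply/funext => w /=; rewrite addrA.
  exact: continuous_affine_form.
have -> : snd \o (fun z : R * R =>
  (p * z.1 + (q * z.2 + e), r * z.2 + s)) = (fun z => 0 * z.1 + r * z.2 + s).
  by apply/funext => w /=; rewrite mul0r add0r.
exact: continuous_affine_form.
Qed.

(** For fixed y the map is affine in x alone, so that Tonelli's theorem reduces
    it to two one-dimensional substitutions.  Triangular maps are enough here: a
    triangle with a side on the x-axis is the image of the reference triangle
    by such a map, and with the exchange of coordinates such maps generate
    the symmetries of the reference triangle. *)
Lemma ge0_integral_upper_affine p q r e s (f : mplane -> \bar R) :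
  p != 0 -> r != 0 -> measurable_fun setT f -> (forall z, 0 <= f z)%E ->
  (\int[leb2]_z f (p * z.1 + (q * z.2 + e), r * z.2 + s)%R
     = (`|p|^-1 * `|r|^-1)%:E * \int[leb2]_z f z)%E.
Proof.
move=> p0 r0 mf f0; rewrite /leb2.
have mA (a b : R) : measurable_fun [set: measurableTypeR R] (fun x : R => a * x + b).
  apply: continuous_measurable_fun => x.
  by apply: continuousD; [apply: continuousM;
    [exact: cvg_cst|exact: cvg_id]|exact: cvg_cst].
rewrite fubini_tonelli2//; last first.
  apply: (@measurableT_comp _ _ _ _ _ _ f) => //.
  exact: measurable_upper_affine.
rewrite fubini_tonelli2// /fubini_G/=.
transitivity (\int[leb]_y (`|p|^-1%:E * \int[leb]_x f (x, (r * y + s)%R)))%E.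
  apply: eq_integral => y _;
    rewrite -(@ge0_integral_affine _ p (q * y + e)%R (fun x => f (x, (r * y + s)%R)))//.
  exact: measurable_fun_pair1.
rewrite ge0_integralZl//.
- rewrite (@ge0_integral_affine _ r s (fun y => \int[leb]_x f (x, y))%E)//.
  + by rewrite muleA EFinM.
  + exact: measurable_fun_fubini_tonelli_G.
  + by move=> y; exact: integral_ge0.
- apply: (@measurableT_comp _ _ _ _ _ _ (fun y =>
    \int[leb]_x f (x, y))%E _ (fun x : R => r * x + s)) => //.
    exact: measurable_fun_fubini_tonelli_G.
  exact: mA.
- by move=> y _; exact: integral_ge0.
Qed.

Lemma ge0_integral_swap (f : mplane -> \bar R) :
  measurable_fun setT f -> (forall z, 0 <= f z)%E ->
  (\int[leb2]_z f (z.2, z.1) = \int[leb2]_z f z)%E.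
Proof.
move=> mf f0; rewrite /leb2 fubini_tonelli1//; last first.
  by apply: (@measurableT_comp _ _ _ _ _ _ f _ (fun z : mplane => (z.2, z.1)) mf);
    exact: measurable_swap.
by rewrite fubini_tonelli2.
Qed.

(** The affine map that permutes the vertices of the reference triangle
    cyclically: (0,0) to (1,0) to (0,1) to (0,0). *)
Definition vcycle (z : R * R) : R * R := (1 - z.1 - z.2, z.1).

Definition ref_triangle : set (R * R) := [set z | [/\ 0 < z.1, 0 < z.2 & z.1 + z.2 < 1]].

Lemma open_ref_triangle : open ref_triangle.
Proof.
suff -> : ref_triangle = [set z :
  R * R | 0 < z.1] `&` [set z | 0 < z.2] `&` [set z | 0 < -1 * z.1 + -1 * z.2 + 1].
  apply: openI; first apply: openI.
  - by apply: open_comp (@open_gt R 0) => z _; exact: cvg_fst.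
  - by apply: open_comp (@open_gt R 0) => z _; exact: cvg_snd.
  - by apply: open_comp (@open_gt R 0) => z _; exact: continuous_affine_form.
by apply/seteqP; split => z /=; [case => *|case=> -[] *]; do ?split; lra.
Qed.

Lemma measurable_ref_triangle : measurable (ref_triangle : set mplane).
Proof. exact: open_plane_measurable open_ref_triangle. Qed.

Lemma measurable_vcycle : measurable_fun [set: mplane] (vcycle : mplane -> mplane).
Proof.
apply/measurable_fun_pairP; split; last exact: measurable_fst.
apply: continuous_plane_measurable => z.
have -> : fst \o vcycle = (fun z => -1 * z.1 + -1 * z.2 + 1).
  by apply/funext => w; rewrite /vcycle/=; ring.
exact: continuous_affine_form.
Qed.

Lemma ge0_integral_vcycle (f : mplane -> \bar R) :
  measurable_fun setT f -> (forall z, 0 <= f z)%E ->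
  (\int[leb2]_z f (vcycle z) = \int[leb2]_z f z)%E.
Proof.
move=> mf f0.
have := @ge0_integral_upper_affine (-1) (-1) 1 1 0 f;
  rewrite oppr_eq0 oner_eq0 => /(_ isT isT mf f0).
rewrite normrN1 normr1 invr1 mulr1 mul1e => <-.
rewrite -ge0_integral_swap.
- by apply: eq_integral => z _ /=; rewrite /vcycle; congr (f (_, _)); ring.
- exact: (measurableT_comp mf measurable_vcycle).
- by move=> z.
Qed.

Lemma integral_vcycle (f : mplane -> \bar R) :
  measurable_fun setT f ->
  (\int[leb2]_z f (vcycle z) = \int[leb2]_z f z)%E.
Proof.
move=> mf; rewrite integralE [RHS]integralE.
congr (_ - _)%E; rewrite -[RHS]ge0_integral_vcycle//.
- by rewrite -/(f \o vcycle) funepos_comp.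
- exact: measurable_funepos.
- by rewrite -/(f \o vcycle) funeneg_comp.
- exact: measurable_funeneg.
Qed.

Lemma Rintegral_vcycle (F : R * R -> R) : continuous F ->
  \int[leb2]_(z in ref_triangle) F (vcycle z) = \int[leb2]_(z in ref_triangle) F z.
Proof.
move=> cF; rewrite /Rintegral; congr fine.
rewrite integral_mkcond [RHS]integral_mkcond -[RHS]integral_vcycle.
  apply: eq_integral => z _; rewrite /patch.
  have -> // : (z \in ref_triangle) = (vcycle z \in ref_triangle).
  by apply/idP/idP => /[!inE] -[/= ? ? ?]; split => /=; lra.
apply/(measurable_restrictT _ measurable_ref_triangle).
apply/measurable_EFinP/measurable_funTS.
exact: continuous_plane_measurable.
Qed.
End ChangeOfVariables.

(** * Smooth functions and affine maps *)

Section Smooth.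
Context {R : realType}.
Implicit Types (f g : R * R -> R) (p v w : R * R).

Lemma differentiable_affine_form (a b c : R) (p : R * R) :
  differentiable (fun z : R * R => a * z.1 + b * z.2 + c) p.
Proof.
apply: differentiableD; last exact: differentiable_cst.
apply: differentiableD.
  by apply: differentiableZ; apply: linear_differentiable => z; exact: cvg_fst.
by apply: differentiableZ; apply: linear_differentiable => z; exact: cvg_snd.
Qed.

(** The linear part [l] is kept as a separate argument because it is the
    direction in which derivatives are taken after composition. *)
Record is_affine (L l : R * R -> R * R) : Prop := IsAffine {
  affine_translate : forall (h : R) v p, L (h *: v + p) = h *: l v + L p ;
  affine_differentiable : forall p, differentiable L p }.

Lemma affine_continuous L l : is_affine L l -> continuous L.
Proof. by move=> [_ dL] p; exact: differentiable_continuous. Qed.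

(** The two difference quotients are the same function of the increment. *)
Lemma derive_affine L l f v : is_affine L l ->
  'D_v (f \o L) = 'D_(l v) f \o L.
Proof.
move=> [tL _]; apply/funext => p /=; rewrite /derive/=.
by under eq_fun do rewrite tL.
Qed.

Lemma is_Ck_affine n L l f : is_affine L l -> is_Ck n f -> is_Ck n (f \o L).
Proof.
move=> aL; elim: n f => [|n IH] f /=.
  move=> cf p; apply: continuous_comp; last exact: cf.
  exact: affine_continuous aL _.
move=> [df cf]; split=> [p|v].
  by apply: differentiable_comp; [exact: affine_differentiable aL _|exact: df].
by rewrite (derive_affine _ _ aL); exact: IH.
Qed.

Lemma smooth_affine L l f : is_affine L l -> smooth f -> smooth (f \o L).
Proof. by move=> aL sf n; exact: is_Ck_affine aL (sf n). Qed.

Lemma is_Ck_cst n (k : R) : is_Ck n (cst k : R * R -> R).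
Proof.
elim: n k => [|n IH] k /=; first by move=> p; exact: cvg_cst.
split=> [p|v]; first exact: differentiable_cst.
rewrite (_ : 'D_v _ = cst 0) //; apply/funext => p; exact: derive_cst.
Qed.

Lemma smooth_cst (k : R) : smooth (cst k : R * R -> R).
Proof. by move=> n; exact: is_Ck_cst. Qed.

Lemma smooth_differentiable f p : smooth f -> differentiable f p.
Proof. by move=> /(_ 1%N)[+ _]; exact. Qed.

Lemma smooth_derive f v : smooth f -> smooth ('D_v f).
Proof. by move=> sf n; have [_] := sf n.+1; exact. Qed.

Lemma smooth_continuous f : smooth f -> continuous f.
Proof. by move=> /(_ 0%N). Qed.

Lemma smooth_deriveD f v w (a b : R) : smooth f ->
  'D_(a *: v + b *: w) f = (fun p => a * 'D_v f p + b * 'D_w f p).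
Proof.
move=> sf; apply/funext => p.
rewrite !deriveE; try exact: smooth_differentiable.
by rewrite linearD !linearZ.
Qed.

Lemma differentiable_derivable_x f (x y : R) : differentiable f (x, y) ->
  is_derive x 1 (fun x => f (x, y)) ('D_e1 f (x, y)).
Proof.
move=> df.
have Df : derivable f (x, y) e1 by exact: diff_derivable.
have E : (fun h : R => h^-1 *: (((fun x => f (x, y)) \o shift x) (h *: 1) - f (x, y)))
  = (fun h => h^-1 *: ((f \o shift (x, y)) (h *: e1) - f (x, y))).
  apply/funext => h /=; congr (_ *: (f _ - _)).
  by rewrite /e1/shift/=; congr (_, _); rewrite /= /GRing.scale/= mulr0 add0r.
apply: DeriveDef; first by rewrite /derivable E.
by rewrite /derive E.
Qed.

Lemma differentiable_derivable_y f (x y : R) : differentiable f (x, y) ->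
  is_derive y 1 (fun y => f (x, y)) ('D_e2 f (x, y)).
Proof.
move=> df.
have Df : derivable f (x, y) e2 by exact: diff_derivable.
have E : (fun h : R => h^-1 *: (((fun y => f (x, y)) \o shift y) (h *: 1) - f (x, y)))
  = (fun h => h^-1 *: ((f \o shift (x, y)) (h *: e2) - f (x, y))).
  apply/funext => h /=; congr (_ *: (f _ - _)).
  by rewrite /e2/shift/=; congr (_, _); rewrite /= /GRing.scale/= mulr0 add0r.
apply: DeriveDef; first by rewrite /derivable E.
by rewrite /derive E.
Qed.

Lemma affine_pair (a b c a' b' c' : R) :
  is_affine (fun z : R * R => (a * z.1 + b * z.2 + c, a' * z.1 + b' * z.2 + c'))
    (fun v => (a * v.1 + b * v.2, a' * v.1 + b' * v.2)).
Proof.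
split=> [h [v1 v2] [p1 p2]|p]; last first.
  by apply: differentiable_pair; exact: differentiable_affine_form.
have E (s t : R) : h *: (s, t) = (h * s, h * t) by [].
by rewrite !E /=; congr (_, _); rewrite /=; ring.
Qed.

Lemma affine_vcycle : is_affine vcycle (fun v : R * R => (- v.1 - v.2, v.1)).
Proof.
have := affine_pair (-1) (-1) 1 1 0 0.
congr is_affine; apply/funext => z /=; rewrite /vcycle; congr (_, _); ring.
Qed.

End Smooth.

(** * Classical derivatives are weak derivatives *)

Section WeakDerivative.
Context {R : realType}.
Local Notation mplane := (measurableTypeR R * measurableTypeR R)%type.
Implicit Types (f g : R * R -> R) (p v w : R * R).

Lemma continuous_x f (y : R) : continuous f -> continuous (fun x => f (x, y)).
Proof.
move=> cf x; apply: (@continuous_comp _ _ _ (fun x => (x, y)) f); last exact: cf.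
by apply: (@cvg_pair _ _ _ _ (nbhs x) (nbhs y)); [exact: cvg_id|exact: cvg_cst].
Qed.

Lemma continuous_y f (x : R) : continuous f -> continuous (fun y => f (x, y)).
Proof.
move=> cf y; apply: (@continuous_comp _ _ _ (fun y => (x, y)) f); last exact: cf.
by apply: (@cvg_pair _ _ _ _ (nbhs x) (nbhs y)); [exact: cvg_cst|exact: cvg_id].
Qed.

Lemma integral_derivative (F f : R -> R) (a b : R) : a <= b ->
  (forall x : R, is_derive x 1 F (f x)) -> continuous f ->
  (\int[leb]_(x in `[a, b]) (f x)%:E = (F b - F a)%:E)%E.
Proof.
rewrite le_eqVlt => /predU1P[-> _ _|ab dF cf].
  by rewrite set_itv1 integral_set1 subrr.
have cF : continuous F.
  by move=> x; apply: differentiable_continuous; apply/derivable1_diffP; have [] := dF x.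
rewrite (continuous_FTC2 ab _ _ _ (F := F)) //.
- exact: continuous_subspaceT.
- split=> [x _||]; first by have [] := dF x.
  + by apply: cvg_at_right_filter; exact: cF.
  + by apply: cvg_at_left_filter; exact: cF.
- by move=> x _; rewrite derive1E; have [_ ->] := dF x.
Qed.

Definition square (M : R) : set (R * R) := `[- M, M]%classic `*` `[- M, M]%classic.

Lemma measurable_square M : measurable (square M : set mplane).
Proof. by apply: measurableX; exact: measurable_itv. Qed.

Lemma integrable_square f M : continuous f ->
  leb2.-integrable (square M : set mplane) (EFin \o f).
Proof.
move=> cf; apply: measurable_bounded_integrable.
- exact: measurable_square.
- pose I : set R := `[- M, M]%classic.
  have -> : leb2 (square M : set mplane) = (leb I * leb I)%E.
    by apply: product_measure1E; exact: measurable_itv.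
  by rewrite !lebesgue_measure_itv/=; case: ifP => _; rewrite ?mule0 -?EFinB -?EFinM ltry.
- by apply: measurable_funTS; exact: continuous_plane_measurable.
- have /compact_bounded : compact (f @` square M).
    apply: continuous_compact; first exact: continuous_subspaceT.
    by apply: compact_setX; exact: segment_compact.
  case=> B [Br hB]; exists B; split => // C BC p sp; apply: hB BC _ _.
  by exists p.
Qed.

Lemma integrable_square_support f M : continuous f ->
  (forall p, ~ square M p -> f p = 0) -> leb2.-integrable setT (EFin \o f).
Proof.
move=> cf f0; have -> : EFin \o f = (EFin \o f) \_ (square M).
  apply/funext => p; rewrite patchE; case: ifPn => // /negP.
  by rewrite inE => /f0 /= ->.
apply/(integrable_restrict _ (measurable_square M) measurableT).
by rewrite setTI; exact: integrable_square.
Qed.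

Lemma compact_sub_square (K : set (R * R)) : compact K ->
  exists2 M : R, 0 < M & forall p, K p -> `|p.1| < M /\ `|p.2| < M.
Proof.
move=> /compact_bounded[B [_ hB]]; exists (`|B| + 2) => [|p Kp].
  by have := normr_ge0 B; lra.
have : B < `|B| + 1 by have := ler_norm B; lra.
move=> /hB /(_ _ Kp); rewrite /= prod_normE/= ge_max => /andP[]; lra.
Qed.

Lemma derive_outside_support f (K : set (R * R)) v p : compact K ->
  (forall p, ~ K p -> f p = 0) -> ~ K p -> 'D_v f p = 0.
Proof.
move=> cK f0 Kp; rewrite -(derive_cst 0 p v); apply: near_eq_derive.
have oK : open (~` K) by apply: closed_openC; apply: compact_closed cK;
  exact: norm_hausdorff.
by apply: filterS (open_nbhs_nbhs (conj oK Kp)) => q /f0 ->.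
Qed.

(** By Fubini's theorem it is enough to integrate along the lines in the
    direction of [v], where the fundamental theorem of calculus applies. *)
Lemma integral_derive_compact_support f (v : R * R) M : v = e1 \/ v = e2 ->
  (forall p, differentiable f p) -> continuous ('D_v f) ->
  (forall p, ~ (`|p.1| < M /\ `|p.2| < M) -> f p = 0) ->
  (forall p, ~ (`|p.1| < M /\ `|p.2| < M) -> 'D_v f p = 0) ->
  (\int[leb2]_p ('D_v f p)%:E = 0)%E.
Proof.
move=> hv df cdf f0 df0.
have idf : leb2.-integrable setT (EFin \o 'D_v f).
  apply: (@integrable_square_support _ M) => // p np; apply: df0 => -[].
  rewrite !ltr_norml => /andP[? ?] /andP[? ?]; apply: np.
  by split => /=; rewrite in_itv/=; apply/andP; split; exact: ltW.
have slice (F g : R -> R) : (forall x : R, is_derive x 1 F (g x)) -> continuous g ->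
    (forall x, ~ `|x| < M -> F x = 0) -> (forall x, ~ `|x| < M -> g x = 0) ->
    (\int[leb]_x (g x)%:E = 0)%E.
  move=> dF cg F0 g0; have [M0|M0] := ltP 0 M; last first.
    rewrite (eq_integral (cst 0%E)) ?integral0// => x _; rewrite g0//.
    by apply/negP; rewrite -leNgt (le_trans M0).
  have := @integral_derivative F g (- M) M _ dF cg.
  have FM : F M = 0 by apply: F0; rewrite gtr0_norm// ltxx.
  have FN : F (- M) = 0 by apply: F0; rewrite normrN gtr0_norm// ltxx.
  rewrite FM FN subrr => E0; apply: etrans (E0 _); last lra.
  rewrite [RHS]integral_mkcond; apply: eq_integral => x _.
  rewrite patchE; case: ifPn => // /negP; rewrite inE/= in_itv/= => nx.
  by rewrite g0//; rewrite ltr_norml => /andP[? ?]; apply: nx; apply/andP; split;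
    exact: ltW.
case: hv => ?; subst v.
- rewrite /leb2 -integral21_prod_meas1//.
  rewrite (eq_integral (cst 0%E)) ?integral0// => y _; rewrite /fubini_G.
  apply: (@slice (fun x => f (x, y)) (fun x => 'D_e1 f (x, y))) => [x|||].
  + exact: differentiable_derivable_x.
  + exact: (continuous_x (f := 'D_e1 f)) cdf.
  + by move=> x nx; apply: f0 => -[].
  + by move=> x nx; apply: df0 => -[].
- rewrite /leb2 -integral12_prod_meas1//.
  rewrite (eq_integral (cst 0%E)) ?integral0// => x _; rewrite /fubini_F.
  apply: (@slice (fun y => f (x, y)) (fun y => 'D_e2 f (x, y))) => [y|||].
  + exact: differentiable_derivable_y.
  + exact: (continuous_y (f := 'D_e2 f)) cdf.
  + by move=> y ny; apply: f0 => -[].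
  + by move=> y ny; apply: df0 => -[].
Qed.

(** For a test function [phi] the product rule turns the claim into the
    vanishing of the integral of the derivative of [f * phi], whose support is
    compact and contained in [Omega]. *)
Lemma smooth_weak_derivative (Omega : set mplane) f (v : R * R) : v = e1 \/ v = e2 ->
  measurable Omega -> smooth f -> weak_derivative Omega v f ('D_v f).
Proof.
move=> hv mO sf phi [sphi [K [cK KO phi0]]].
have dphi0 p : ~ K p -> 'D_v phi p = 0 by exact: derive_outside_support cK phi0.
have [M M0 KM] := compact_sub_square cK.
have cf := smooth_continuous sf; have cphi := smooth_continuous sphi.
have cdf := smooth_continuous (smooth_derive v sf).
have cdphi := smooth_continuous (smooth_derive v sphi).
have out p : ~ (`|p.1| < M /\ `|p.2| < M) -> ~ K p by move=> np /KM.
have out' p : ~ square M p -> ~ K p.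
  move=> np /KM [] /=; rewrite !ltr_norml => /andP[? ?] /andP[? ?]; apply: np.
  by split => /=; rewrite in_itv/=; apply/andP; split; exact: ltW.
have c1 : continuous (fun p => f p * 'D_v phi p).
  by move=> p; apply: cvgM; [exact: cf|exact: cdphi].
have c2 : continuous (fun p => 'D_v f p * phi p).
  by move=> p; apply: cvgM; [exact: cdf|exact: cphi].
have i1 : leb2.-integrable setT (EFin \o (fun p => f p * 'D_v phi p)).
  by apply: (integrable_square_support (M := M)) => // p /out' /dphi0 ->; rewrite mulr0.
have i2 : leb2.-integrable setT (EFin \o (fun p => 'D_v f p * phi p)).
  by apply: (integrable_square_support (M := M)) => // p /out' /phi0 ->; rewrite mulr0.
have j1 := integrableS measurableT mO (@subsetT _ _) i1.
have j2 := integrableS measurableT mO (@subsetT _ _) i2.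
apply/eqP; rewrite -addr_eq0 -RintegralD//; apply/eqP.
pose G : R * R -> R := f * phi.
have D : 'D_v G = (fun p => f p * 'D_v phi p + 'D_v f p * phi p).
  apply/funext => p; rewrite deriveM; try by apply: diff_derivable;
    exact: smooth_differentiable.
  by rewrite [X in _ = _ + X]mulrC.
rewrite Rintegral_mkcond /Rintegral.
transitivity (fine (\int[leb2]_p ('D_v G p)%:E)%E).
  congr fine; apply: eq_integral => p _.
  have -> : 'D_v G p = f p * 'D_v phi p + 'D_v f p * phi p by exact: (congr1 (@^~ p) D).
  rewrite patchE; case: ifPn => // /negP; rewrite inE => np.
  have nK : ~ K p by move=> /KO.
  by rewrite phi0// dphi0// !mulr0 addr0.
rewrite (@integral_derive_compact_support _ _ M)//.
- by move=> p; apply: differentiableM; exact: smooth_differentiable.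
- by rewrite D => p; apply: cvgD; [exact: c1|exact: c2].
- by move=> p /out /phi0 pp; rewrite /= -[LHS]/(f p * phi p) pp mulr0.
- move=> p /out nK.
  have -> : 'D_v G p = f p * 'D_v phi p + 'D_v f p * phi p by exact: (congr1 (@^~ p) D).
  by rewrite phi0// dphi0// !mulr0 addr0.
Qed.

End WeakDerivative.

(** * Barycentric coordinates on the triangles *)

Section Triangle.
Context {R : realType}.
Local Notation mplane := (measurableTypeR R * measurableTypeR R)%type.
Implicit Types (f g W : R * R -> R) (p v w z : R * R) (S a c : R).

Definition ref_int f : R := \int[leb2]_(z in (ref_triangle : set mplane)) f z.

Lemma integrable_ref f : continuous f ->
  leb2.-integrable (ref_triangle : set mplane) (EFin \o f).
Proof.
move=> cf; apply: integrableS (@integrable_square _ f 1 cf).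
- exact: measurable_square.
- exact: measurable_ref_triangle.
- by move=> z [/= ? ? ?]; split => /=; rewrite in_itv/=; apply/andP; split; lra.
Qed.

Lemma ref_intE f : continuous f ->
  (\int[leb2]_(z in (ref_triangle : set mplane)) (f z)%:E = (ref_int f)%:E)%E.
Proof.
move=> cf; rewrite /ref_int /Rintegral fineK//.
by apply: integrable_fin_num (integrable_ref cf); exact: measurable_ref_triangle.
Qed.

Lemma ref_int_ge0 f : (forall z, ref_triangle z -> 0 <= f z) -> 0 <= ref_int f.
Proof. by move=> f0; apply: Rintegral_ge0. Qed.

Lemma ref_intD f g : continuous f -> continuous g ->
  ref_int (fun z => f z + g z) = ref_int f + ref_int g.
Proof.
move=> cf cg; apply: RintegralD; [exact: measurable_ref_triangle|exact: integrable_ref..].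
Qed.

Lemma ref_intZ k f : continuous f -> ref_int (fun z => k * f z) = k * ref_int f.
Proof.
move=> cf; apply: RintegralZl; [exact: measurable_ref_triangle|exact: integrable_ref].
Qed.

Lemma le_ref_int f g : continuous f -> continuous g ->
  (forall z, ref_triangle z -> f z <= g z) -> ref_int f <= ref_int g.
Proof.
move=> cf cg fg; apply: le_Rintegral => //;
  [exact: measurable_ref_triangle|exact: integrable_ref..].
Qed.

Lemma ref_int_vcycle f : continuous f -> ref_int (f \o vcycle) = ref_int f.
Proof. exact: Rintegral_vcycle. Qed.

(** The coordinates of [p] with respect to the second and third vertices of the
    triangle (-c,0), (c,0), (a,S/c).  The zero terms keep the shape of
    [affine_pair]. *)
Definition bary S a c p : R * R :=
  ((2 * c)^-1 * p.1 + (- (a + c) / (2 * S)) * p.2 + 2^-1, 0 * p.1 + c / S * p.2 + 0).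

Lemma affine_bary S a c : is_affine (bary S a c)
  (fun v => ((2 * c)^-1 * v.1 + (- (a + c) / (2 * S)) * v.2, 0 * v.1 + c / S * v.2)).
Proof. exact: affine_pair. Qed.

Definition vA c : R * R := (- c, 0).
Definition vB c : R * R := (c, 0).
Definition vC S a c : R * R := (a, S / c).
Definition tri S a c := triangle (vA c) (vB c) (vC S a c).

Lemma tri_bary S a c : 0 < S -> 0 < c -> tri S a c = bary S a c @^-1` ref_triangle.
Proof.
move=> S0 c0; have S0' : S != 0 by lra. have c0' : c != 0 by lra.
apply/seteqP; split => [p [x [y [z [x0 y0 z0 xyz ->]]]]|[p1 p2]] /=.
  have -> : bary S a c (x *: vA c + y *: vB c + z *: vC S a c) = (y, z).
    rewrite /bary/=; rewrite -![_ *: _]/(_ * _).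
    have -> : x = 1 - y - z by lra.
    by congr (_, _); field; rewrite ?S0' ?c0'.
  by split => /=; lra.
case=> /=; set y := (2 * c)^-1 * _ + _ + _; set z := _ + _ + 0 => y0 z0 yz.
exists (1 - y - z), y, z; split => //; [lra|lra|].
by congr (_, _); rewrite /= -![_ *: _]/(_ * _) /y/z; field; rewrite ?S0' ?c0'.
Qed.

Lemma measurable_tri S a c : 0 < S -> 0 < c -> measurable (tri S a c : set mplane).
Proof.
move=> S0 c0; rewrite tri_bary//; apply: open_plane_measurable.
apply: open_comp open_ref_triangle => p _.
exact: affine_continuous (affine_bary S a c) p.
Qed.

Lemma bary_param S a c (x y : R) : 0 < S -> 0 < c ->
  bary S a c (2 * c * x + ((a + c) * y + - c), S / c * y + 0) = (x, y).
Proof.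
move=> S0 c0; have S0' : S != 0 by lra. have c0' : c != 0 by lra.
by rewrite /bary /=; congr (_, _); field; rewrite ?S0' ?c0'.
Qed.

(** The substitution by the inverse of [bary], whose Jacobian is twice the
    area. *)
Lemma sqnorm_tri S a c g : 0 < S -> 0 < c -> continuous g ->
  sqnorm (tri S a c) (g \o bary S a c) = (2 * S * ref_int (fun z => g z ^+ 2))%:E.
Proof.
move=> S0 c0 cg.
have cg2 : continuous (fun z => g z ^+ 2) by move=> z; apply: cvgM; exact: cg.
rewrite /sqnorm integral_mkcond.
set h := (_ \_ _) => /=.
have mh : measurable_fun [set: mplane] h.
  apply/(measurable_restrictT _ (measurable_tri a S0 c0)).
  apply/measurable_EFinP/measurable_funTS; apply: continuous_plane_measurable => p.
  apply: (@continuous_comp _ _ _ (bary S a c) (fun z => g z ^+ 2)); last exact: cg2.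
  exact: affine_continuous (affine_bary S a c) p.
have h0 z : (0 <= h z)%E by rewrite /h patchE; case: ifP => // _; rewrite lee_fin sqr_ge0.
have c20 : 2 * c != 0 by lra.
have Sc0 : S / c != 0 by rewrite mulf_neq0// ?invr_eq0; lra.
have := ge0_integral_upper_affine (a + c) (- c) 0 c20 Sc0 mh h0.
have -> : `|2 * c|^-1 * `|S / c|^-1 = (2 * S)^-1.
  rewrite !gtr0_norm ?divr_gt0//; last lra.
  by field; rewrite ?gt_eqF.
move=> E; transitivity ((2 * S)%:E * ((2 * S)^-1%:E * \int[leb2]_z h z))%E.
  by rewrite muleA -EFinM mulfV ?mul1e//; lra.
rewrite -E [RHS]EFinM -ref_intE//; congr (_ * _)%E.
rewrite [RHS]integral_mkcond; apply: eq_integral => -[x y] _.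
rewrite /h !patchE/= bary_param//.
have -> : ((2 * c * x + ((a + c) * y + - c), S / c * y + 0) \in tri S a c)
  = ((x, y) \in ref_triangle).
  by rewrite tri_bary//; apply/idP/idP; rewrite !inE /= bary_param.
by [].
Qed.

(** The images under [bary] of the parametrised edges of the triangle. *)
Definition sideAB (s : R) : R * R := (s, 0).
Definition sideBC (s : R) : R * R := (1 - s, s).
Definition sideCA (s : R) : R * R := (0, 1 - s).
Definition side_int (e : R -> R * R) g : R := \int[leb]_(s in `[0, 1]) (g (e s) ^+ 2).

Definition lAB c : R := edge_length (vA c, vB c).
Definition lBC S a c : R := edge_length (vB c, vC S a c).
Definition lCA S a c : R := edge_length (vC S a c, vA c).

Lemma continuous_side : [/\ continuous sideAB, continuous sideBC & continuous sideCA].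
Proof.
split => s; apply: (@cvg_pair _ _ _ _ (nbhs _) (nbhs _)).
- exact: cvg_id.
- exact: cvg_cst.
- by apply: cvgB; [exact: cvg_cst|exact: cvg_id].
- exact: cvg_id.
- exact: cvg_cst.
- by apply: cvgB; [exact: cvg_cst|exact: cvg_id].
Qed.

Lemma integrable_side e g : continuous e -> continuous g ->
  leb.-integrable (`[0, 1]%classic : set R) (EFin \o (fun s => g (e s) ^+ 2)).
Proof.
move=> ce cg; apply: continuous_compact_integrable; first exact: segment_compact.
apply: continuous_subspaceT => s.
have cge : g (e t) @[t --> s] --> g (e s).
  by apply: (@continuous_comp _ _ _ e g); [exact: ce|exact: cg].
exact: cvgM.
Qed.

Lemma side_intE e g : continuous e -> continuous g ->
  (\int[leb]_(s in `[0%R, 1%R]) (g (e s) ^+ 2)%:E = (side_int e g)%:E)%E.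
Proof.
move=> ce cg; rewrite /side_int /Rintegral fineK//.
by apply: integrable_fin_num (integrable_side ce cg).
Qed.

Lemma measurable_edge f (e : R * R * (R * R)) : continuous f ->
  measurable_fun (`[0, 1]%classic : set R) (fun s : R => f (edge_point e s)).
Proof.
move=> cf; apply: measurable_funTS; apply: continuous_measurable_fun => s.
apply: (@continuous_comp _ _ _ (edge_point e) f); last exact: cf.
by apply: cvgD; [exact: cvg_cst|exact: scalel_continuous].
Qed.

Lemma bary_edges S a c : 0 < S -> 0 < c ->
  [/\ bary S a c \o edge_point (vA c, vB c) = sideAB,
      bary S a c \o edge_point (vB c, vC S a c) = sideBC &
      bary S a c \o edge_point (vC S a c, vA c) = sideCA].
Proof.
move=> S0 c0; have S0' : S != 0 by lra. have c0' : c != 0 by lra.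
split; apply/funext => s; rewrite /bary/edge_point/=; rewrite -![_ *: _]/(_ * _);
  by congr (_, _); field; rewrite ?S0' ?c0'.
Qed.

Definition tri_edges S a c := triangle_edges (vA c) (vB c) (vC S a c).

(** [bary] carries the affine parametrisation of each edge to that of the
    corresponding reference side, so that only the lengths depend on the
    triangle. *)
Lemma bd_sqnorm_tri S a c g : 0 < S -> 0 < c -> continuous g ->
  bd_sqnorm (tri_edges S a c) (g \o bary S a c) =
  (lAB c * side_int sideAB g + lBC S a c * side_int sideBC g
    + lCA S a c * side_int sideCA g)%:E.
Proof.
move=> S0 c0 cg; have [E1 E2 E3] := bary_edges a S0 c0.
have [c1 c2 c3] := continuous_side.
rewrite /bd_sqnorm !big_cons big_nil adde0 addeA !EFinD !EFinM -!side_intE//.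
by rewrite -E1 -E2 -E3.
Qed.

End Triangle.

(** * Smooth functions are admissible competitors *)

Section Trial.
Context {R : realType}.
Local Notation mplane := (measurableTypeR R * measurableTypeR R)%type.
Implicit Types (f g W : R * R -> R) (p v w z : R * R) (S a c alpha : R).

Definition mass W := ref_int (fun z => W z ^+ 2).

(** The linear part of [bary] applied to the two coordinate vectors: the
    directions in which a function of the barycentric coordinates has to be
    differentiated to obtain the gradient on the triangle. *)
Definition gradx c : R * R := ((2 * c)^-1, 0).
Definition grady S a c : R * R := (- (a + c) / (2 * S), c / S).

Definition grad_mass S a c W := mass ('D_(gradx c) W) + mass ('D_(grady S a c) W).

Definition bd_mass S a c W :=
  lAB c * side_int sideAB W + lBC S a c * side_int sideBC W
    + lCA S a c * side_int sideCA W.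

Definition energy S a c alpha W :=
  2 * S * grad_mass S a c W + alpha * bd_mass S a c W.

Lemma smooth_L2 S a c W :
  0 < S -> 0 < c -> continuous W -> L2 (tri S a c) (W \o bary S a c).
Proof.
move=> S0 c0 cW; split; last by rewrite sqnorm_tri// ltry.
apply: measurable_funTS; apply: continuous_plane_measurable => p.
apply: (@continuous_comp _ _ _ (bary S a c) W); last exact: cW.
exact: affine_continuous (affine_bary S a c) p.
Qed.

Lemma derive_bary S a c W : 'D_e1 (W \o bary S a c) = 'D_(gradx c) W \o bary S a c
  /\ 'D_e2 (W \o bary S a c) = 'D_(grady S a c) W \o bary S a c.
Proof.
have E1 : ((2 * c)^-1 * (@e1 R).1 + (- (a + c) / (2 * S)) * (@e1 R).2,
    0 * (@e1 R).1 + c / S * (@e1 R).2) = gradx c.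
  by rewrite /gradx /e1 /= !mulr1 !mulr0 !addr0.
have E2 : ((2 * c)^-1 * (@e2 R).1 + (- (a + c) / (2 * S)) * (@e2 R).2,
    0 * (@e2 R).1 + c / S * (@e2 R).2) = grady S a c.
  by rewrite /grady /e2 /= !mulr1 !mulr0 !add0r.
have D v := derive_affine W v (affine_bary S a c).
split; first exact: etrans (D e1) (congr1 (fun v : R * R => 'D_v W \o bary S a c) E1).
exact: etrans (D e2) (congr1 (fun v : R * R => 'D_v W \o bary S a c) E2).
Qed.

Lemma sqnorm0 (Omega : set mplane) : sqnorm Omega (fun=> 0 : R) = 0%E.
Proof.
by rewrite /sqnorm integral0_eq// => p _; rewrite expr0n.
Qed.

(** A smooth function is its own trace: the constant sequence approximates
    it. *)
Lemma lambda_tri_le S a c alpha W : 0 < S -> 0 < c -> smooth W -> 0 < mass W ->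
  (lambda_tri S alpha a c <=
   (energy S a c alpha W / (2 * S * mass W))%:E)%E.
Proof.
move=> S0 c0 sW mW.
have cW := smooth_continuous sW.
have [Dx Dy] := derive_bary S a c W.
pose u := W \o bary S a c.
have su : smooth u by exact: smooth_affine (affine_bary S a c) sW.
have cx := smooth_continuous (smooth_derive (gradx c) sW).
have cy := smooth_continuous (smooth_derive (grady S a c) sW).
apply: ereal_inf_lbound; exists u, ('D_e1 u), ('D_e2 u), u; split.
- split.
  + exact: smooth_L2 S0 c0 cW.
  + by rewrite Dx; exact: smooth_L2 S0 c0 cx.
  + by rewrite Dy; exact: smooth_L2 S0 c0 cy.
  + by apply: smooth_weak_derivative => //; [left|exact: measurable_tri].
  + by apply: smooth_weak_derivative => //; [right|exact: measurable_tri].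
- move=> ae0; have := sqnorm_tri a S0 c0 cW.
  rewrite /sqnorm (ae_eq_integral (cst 0%E)).
  + rewrite integral0 => -[] /esym/eqP; rewrite mulf_eq0 -/(mass W) (gt_eqF mW) orbF.
    by rewrite gt_eqF//; lra.
  + exact: measurable_tri.
  + apply/measurable_EFinP/measurable_funTS; apply: continuous_plane_measurable => p.
    by apply: cvgM; exact: smooth_continuous su p.
  + exact: measurable_cst.
  + case: ae0 => N [mN N0 sN]; exists N; split => //.
    apply: subset_trans sN => p /= np up; apply: np => /up up0.
    by rewrite [W _]up0 expr0n.
- split.
  + split.
    * by move=> e _; apply: measurable_edge; exact: smooth_continuous.
    * by rewrite bd_sqnorm_tri// ltry.
  + exists (fun=> u).
    have E f : (fun p => f p - f p) = (fun=> 0) :> (R * R -> R) by apply/funext => p;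
      rewrite subrr.
    split => //; rewrite ?E.
    * by rewrite sqnorm0; exact: cvg_cst.
    * by rewrite sqnorm0; exact: cvg_cst.
    * by rewrite sqnorm0; exact: cvg_cst.
    * rewrite (_ : bd_sqnorm _ _ = 0%E); first exact: cvg_cst.
      rewrite /bd_sqnorm big1// => e _; rewrite integral0_eq ?mule0// => s _.
      by rewrite expr0n.
- rewrite /robin_quotient Dx Dy (sqnorm_tri a S0 c0 cW) (sqnorm_tri a S0 c0 cx).
  by rewrite (sqnorm_tri a S0 c0 cy) (bd_sqnorm_tri a S0 c0 cW) /energy /grad_mass mulrDr.
Qed.
End Trial.

(** * Smooth approximation of competitors *)

(** Pointwise, f = g + (f - g) and 2 g (f - g) is at most
    eta g^2 + (f - g)^2 / eta. *)
Lemma integral_sqr_le d (T : measurableType d) (R : realType)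
    (mu : {measure set T -> \bar R}) (D : set T) (f g : T -> R) (eta : R) :
  measurable D -> measurable_fun D f -> measurable_fun D g -> 0 < eta ->
  (\int[mu]_(x in D) (f x ^+ 2)%:E <=
    (1 + eta)%R%:E * \int[mu]_(x in D) (g x ^+ 2)%:E +
    (1 + eta^-1)%:E * \int[mu]_(x in D) ((f x - g x) ^+ 2)%:E)%E.
Proof.
move=> mD mf mg eta0; have eta1 : 0 < eta^-1 by rewrite invr_gt0.
have mfg : measurable_fun D (fun x => f x - g x) by exact: measurable_funB.
rewrite -!ge0_integralZl//; first last.
- by rewrite lee_fin; lra.
- by move=> x _; rewrite lee_fin sqr_ge0.
- by apply/measurable_EFinP; exact: measurable_funX.
- by rewrite lee_fin; lra.
- by move=> x _; rewrite lee_fin sqr_ge0.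
- by apply/measurable_EFinP; exact: measurable_funX.
rewrite -ge0_integralD//; first last.
- by under eq_fun do rewrite -EFinM; apply/measurable_EFinP;
    apply: measurable_funM => //; exact: measurable_funX.
- by move=> x _; rewrite -EFinM lee_fin mulr_ge0// ?sqr_ge0//; lra.
- by under eq_fun do rewrite -EFinM; apply/measurable_EFinP;
    apply: measurable_funM => //; exact: measurable_funX.
- by move=> x _; rewrite -EFinM lee_fin mulr_ge0// ?sqr_ge0//; lra.
apply: ge0_le_integral => //.
- by move=> x _; rewrite lee_fin sqr_ge0.
- by apply/measurable_EFinP; exact: measurable_funX.
- under eq_fun do rewrite -!EFinM -EFinD; apply/measurable_EFinP.
  by apply: measurable_funD; apply: measurable_funM => //; exact: measurable_funX.
- move=> x _; rewrite -!EFinM -EFinD lee_fin.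
  set u := g x; set v := f x - g x; have -> : f x = u + v by rewrite /u/v; ring.
  rewrite -subr_ge0.
  have -> : (1 + eta) * u ^+ 2 + (1 + eta^-1) * v ^+ 2 - (u + v) ^+ 2
    = eta * (u - eta^-1 * v) ^+ 2.
    by field; lra.
  by rewrite mulr_ge0 ?sqr_ge0//; exact: ltW.
Qed.

(** The two inequalities are the ones that [integral_sqr_le] yields with the
    roles of f and g exchanged; in this form the argument serves both for the
    integral over the triangle and for the boundary sum. *)
Lemma cvg_fine_of_sqr_le (R : realType) (I e : nat -> \bar R) (J : \bar R) :
  (forall n, 0 <= I n)%E -> (0 <= J < +oo)%E -> (forall n, 0 <= e n)%E ->
  e @ \oo --> 0%E ->
  (forall eta : R, (0 < eta)%R -> forall n,
     I n <= (1 + eta)%R%:E * J + (1 + eta^-1)%R%:E * e n)%E ->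
  (forall eta : R, (0 < eta)%R -> forall n,
     J <= (1 + eta)%R%:E * I n + (1 + eta^-1)%R%:E * e n)%E ->
  fine (I n) @[n --> \oo] --> fine J.
Proof.
move=> I0 /andP[]; case: J => [J||]//;
  rewrite lee_fin => J0 _ e0 /fine_cvgP[efin ecvg] IJ JI.
apply/cvgrPdist_lt => eps eps0.
(* The distance from [I n] to [J] is at most 2 eta J + 2 (1 + 1 / eta) e n; this
   choice makes the first term at most eps / 2. *)
pose eta := eps / (4 * (J + eps)).
have eta0 : 0 < eta by rewrite divr_gt0//; lra.
have eta1 : eta <= 4^-1 by rewrite ler_pdivrMr; lra.
have etaJ : eta * J <= eps / 4.
  by rewrite /eta mulrAC ler_pdivrMr; [nra|lra].
pose K := 1 + eta^-1.
have K0 : 0 < K by rewrite addr_gt0// invr_gt0.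
have del0 : 0 < eps / (4 * K) by rewrite divr_gt0//; lra.
have small := cvgr_lt _ ecvg (eps / (4 * K)) del0.
near=> n.
have fe : e n \is a fin_num by near: n; exact: efin.
have le : fine (e n) < eps / (4 * K) by near: n; exact: small.
have ee0 : 0 <= fine (e n) by rewrite fine_ge0.
have := IJ _ eta0 n; have := JI _ eta0 n; have := I0 n.
rewrite -/K -(fineK fe); set E := fine (e n) in le ee0 *.
have KE : K * E < eps / 4.
  rewrite -ltr_pdivlMl// (lt_le_trans le)// le_eqVlt; apply/orP; left; apply/eqP.
  by field; lra.
case: (I n) => [r| |] /=; last by [].
  2: by move=> _ _; rewrite -!EFinM -EFinD.
rewrite -!EFinM -!EFinD !lee_fin => r0 h1 h2.
have r2 : r <= 2 * J + eps by nra.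
rewrite ltr_distl; apply/andP; split; nra.
Unshelve. all: by end_near. Qed.

Section Approximation.
Context {R : realType}.
Local Notation mplane := (measurableTypeR R * measurableTypeR R)%type.
Implicit Types (f g W : R * R -> R) (p v w z : R * R) (S a c alpha : R).

Lemma sqnorm_le (Omega : set mplane) f g (eta : R) : measurable Omega ->
  measurable_fun Omega f -> measurable_fun Omega g -> 0 < eta ->
  (sqnorm Omega f <= (1 + eta)%R%:E * sqnorm Omega g
     + (1 + eta^-1)%R%:E * sqnorm Omega (fun p => (f p - g p)%R))%E.
Proof. by move=> *; exact: integral_sqr_le. Qed.

Lemma bd_sqnorm_le Gamma f g (eta : R) :
  (forall e, e \in Gamma -> measurable_fun (`[0, 1]%classic : set R) (fun s : R =>
    f (edge_point e s))) ->
  (forall e, e \in Gamma -> measurable_fun (`[0, 1]%classic : set R) (fun s : R =>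
    g (edge_point e s))) ->
  0 < eta ->
  (bd_sqnorm Gamma f <= (1 + eta)%R%:E * bd_sqnorm Gamma g
     + (1 + eta^-1)%R%:E * bd_sqnorm Gamma (fun p => (f p - g p)%R))%E.
Proof.
move=> mf mg eta0; have eta1 : 0 < eta^-1 by rewrite invr_gt0.
have b0 (h : R -> R) : (0 <= \int[leb]_(s in `[0%R, 1%R]) (h s ^+ 2)%:E)%E.
  by apply: integral_ge0 => s _; rewrite lee_fin sqr_ge0.
have l0 (e : R * R * (R * R)) : 0 <= edge_length e by exact: sqrtr_ge0.
rewrite /bd_sqnorm !ge0_sume_distrr; try by move=> e _; apply: mule_ge0;
  [rewrite lee_fin|exact: b0].
rewrite -big_split/= !big_seq; apply: lee_sum => e eG.
rewrite !(muleCA _ (edge_length e)%:E) -ge0_muleDr; try by apply: mule_ge0;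
  [rewrite lee_fin; lra|exact: b0].
apply: lee_wpmul2l; first by rewrite lee_fin.
by apply: integral_sqr_le => //; [exact: mf|exact: mg].
Qed.

Lemma sqnorm_opp (Omega : set mplane) f g :
  sqnorm Omega (fun p => (f p - g p)%R) = sqnorm Omega (fun p => g p - f p).
Proof. by apply: eq_integral => p _; rewrite -sqrrN opprB. Qed.

Lemma bd_sqnorm_opp Gamma f g :
  bd_sqnorm Gamma (fun p => (f p - g p)%R) = bd_sqnorm Gamma (fun p => g p - f p).
Proof.
apply: eq_bigr => e _; congr (_ * _)%E.
by apply: eq_integral => p _; rewrite -sqrrN opprB.
Qed.

Lemma sqnorm_ge0 (Omega : set mplane) f : (0 <= sqnorm Omega f)%E.
Proof. by apply: integral_ge0 => p _; rewrite lee_fin sqr_ge0. Qed.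

Lemma bd_sqnorm_ge0 Gamma f : (0 <= bd_sqnorm Gamma f)%E.
Proof.
apply: sume_ge0 => e _; rewrite mule_ge0 ?lee_fin ?sqrtr_ge0//.
by apply: integral_ge0 => s _; rewrite lee_fin sqr_ge0.
Qed.

Lemma cvg_sqnorm (Omega : set mplane) (phi : nat -> R * R -> R) u :
  measurable Omega -> (forall n, continuous (phi n)) -> L2 Omega u ->
  sqnorm Omega (fun p => phi n p - u p) @[n --> \oo] --> 0%E ->
  fine (sqnorm Omega (phi n)) @[n --> \oo] --> fine (sqnorm Omega u).
Proof.
move=> mO cphi [mu uoo] cv.
have mphi n : measurable_fun Omega (phi n).
  by apply: measurable_funTS; exact: continuous_plane_measurable.
apply: cvg_fine_of_sqr_le cv _ _ => [n||n|eta eta0 n|eta eta0 n].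
- exact: sqnorm_ge0.
- by rewrite sqnorm_ge0.
- exact: sqnorm_ge0.
- exact: sqnorm_le.
- by rewrite sqnorm_opp; exact: sqnorm_le.
Qed.

Lemma cvg_bd_sqnorm Gamma (phi : nat -> R * R -> R) t :
  (forall n, continuous (phi n)) -> bd_L2 Gamma t ->
  bd_sqnorm Gamma (fun p => phi n p - t p) @[n --> \oo] --> 0%E ->
  fine (bd_sqnorm Gamma (phi n)) @[n --> \oo] --> fine (bd_sqnorm Gamma t).
Proof.
move=> cphi [mt too] cv.
have mphi n e : e \in Gamma -> measurable_fun (`[0, 1]%classic : set R) (fun s : R =>
  phi n (edge_point e s)).
  by move=> _; exact: measurable_edge.
apply: cvg_fine_of_sqr_le cv _ _ => [n||n|eta eta0 n|eta eta0 n].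
- exact: bd_sqnorm_ge0.
- by rewrite bd_sqnorm_ge0.
- exact: bd_sqnorm_ge0.
- by apply: bd_sqnorm_le => //; exact: mphi.
- by rewrite bd_sqnorm_opp; apply: bd_sqnorm_le => //; exact: mphi.
Qed.

Lemma fine_sqnorm_gt0 (Omega : set mplane) u : measurable Omega -> L2 Omega u ->
  ~ {ae leb2, forall p, Omega p -> u p = 0} -> 0 < fine (sqnorm Omega u).
Proof.
move=> mO [mu uoo] nae; rewrite lt0r fine_ge0 ?sqnorm_ge0// andbT.
rewrite fine_eq0 ?ge0_fin_numE ?sqnorm_ge0//.
apply/negP => /eqP u0; apply: nae.
have mu2 : measurable_fun Omega (fun p => (u p ^+ 2)%:E).
  by apply/measurable_EFinP; exact: measurable_funX.
have /(ae_eq_integral_abs leb2 mO mu2) : (\int[leb2]_(p in Omega) `|(u p ^+ 2)%:E| = 0)%E.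
  by rewrite -u0; apply: eq_integral => p _; rewrite gee0_abs// lee_fin sqr_ge0.
case=> N [mN N0 sN]; exists N; split => //; apply: subset_trans sN => p /= np up.
by apply: np => /up /= [] /eqP; rewrite sqrf_eq0 => /eqP.
Qed.

Definition param S a c z : R * R :=
  (2 * c * z.1 + (a + c) * z.2 + - c, 0 * z.1 + S / c * z.2 + 0).

Lemma paramK S a c : 0 < S -> 0 < c -> param S a c \o bary S a c = id.
Proof.
move=> S0 c0; have S0' : S != 0 by lra. have c0' : c != 0 by lra.
apply/funext => -[x y]; rewrite /param /bary /=.
by congr (_, _); field; rewrite ?S0' ?c0'.
Qed.

(** The functions approximating [u] in the definition of its trace have
    quotients that converge to the quotient of [u]. *)
Lemma smooth_approx_quotient S a c alpha u gx gy t eps : 0 < S -> 0 < c -> 0 < eps ->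
  H1 (tri S a c) u gx gy -> ~ {ae leb2, forall p, tri S a c p -> u p = 0} ->
  is_trace (tri S a c) (tri_edges S a c) u gx gy t ->
  exists W, [/\ smooth W, 0 < mass W &
    energy S a c alpha W / (2 * S * mass W)
      <= robin_quotient alpha (tri S a c) (tri_edges S a c) u gx gy t + eps].
Proof.
move=> S0 c0 eps0 [Lu Lx Ly _ _] nae [Lt [phi [sphi cu cx cy ct]]].
have mO := measurable_tri a S0 c0.
pose V n := phi n \o param S a c.
have sV n : smooth (V n) by exact: smooth_affine (affine_pair _ _ _ _ _ _) (sphi n).
have VE n : phi n = V n \o bary S a c by rewrite /V -compA paramK.
have cV n := smooth_continuous (sV n).
have Nu := fine_sqnorm_gt0 mO Lu nae.
have Cu := cvg_sqnorm mO (fun n => smooth_continuous (sphi n)) Lu cu.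
have Cx := cvg_sqnorm mO (fun n => smooth_continuous (smooth_derive e1 (sphi n))) Lx cx.
have Cy := cvg_sqnorm mO (fun n => smooth_continuous (smooth_derive e2 (sphi n))) Ly cy.
have Ct := cvg_bd_sqnorm (fun n => smooth_continuous (sphi n)) Lt ct.
have CQ : robin_quotient alpha (tri S a c) (tri_edges S a c) (phi n) ('D_e1 (phi n))
  ('D_e2 (phi n)) (phi n)
   @[n --> \oo] --> robin_quotient alpha (tri S a c) (tri_edges S a c) u gx gy t.
  apply: cvgM; last by apply: cvgV => //; rewrite gt_eqF.
  by apply: cvgD; [exact: cvgD|apply: cvgM => //; exact: cvg_cst].
have lQ := cvgr_le _ CQ _ (ltr_pwDr eps0 (lexx _)).
have lN := cvgr_gt _ Cu _ Nu.
near \oo => n.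
have hQ : robin_quotient alpha (tri S a c) (tri_edges S a c) (phi n) ('D_e1 (phi n))
  ('D_e2 (phi n)) (phi n)
  <= robin_quotient alpha (tri S a c) (tri_edges S a c) u gx gy t + eps.
  by near: n; exact: lQ.
have hN : 0 < fine (sqnorm (tri S a c) (phi n)) by near: n; exact: lN.
exists (V n); split => //.
  by move: hN; rewrite VE sqnorm_tri//= pmulr_rgt0//; lra.
apply: le_trans hQ; rewrite /robin_quotient !VE.
have [Dx Dy] := derive_bary S a c (V n).
have cdx := smooth_continuous (smooth_derive (gradx c) (sV n)).
have cdy := smooth_continuous (smooth_derive (grady S a c) (sV n)).
rewrite Dx Dy (sqnorm_tri a S0 c0 (cV n)) (sqnorm_tri a S0 c0 cdx) (sqnorm_tri a S0
  c0 cdy).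
by rewrite (bd_sqnorm_tri a S0 c0 (cV n)) /energy /grad_mass mulrDr.
Unshelve. all: by end_near. Qed.

End Approximation.

(** * The trace inequality *)

Section Slices.
Context {R : realType}.
Local Notation mplane := (measurableTypeR R * measurableTypeR R)%type.
Implicit Types (f g W G : R * R -> R) (p v w z : R * R) (S a c alpha : R).

Lemma integral_derivative_oo (F f : R -> R) (b : R) : 0 < b ->
  (forall x : R, is_derive x 1 F (f x)) -> continuous f ->
  (\int[leb]_(x in `]0%R, b[) (f x)%:E = (F b - F 0)%:E)%E.
Proof.
move=> b0 dF cf; rewrite -(@integral_derivative _ F f 0 b (ltW b0) dF cf).
rewrite -(@integral_itv_bndoo _ 0 b _ true false)//.
by apply/measurable_EFinP; apply: measurable_funTS; exact: continuous_measurable_fun.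
Qed.

(** The fundamental theorem of calculus on the horizontal slices ]0, 1 - y[ of
    the reference triangle. *)
Lemma ref_int_derive_x G g : continuous G -> continuous g ->
  (forall x y : R, is_derive x 1 (fun x => G (x, y)) (g (x, y))) ->
  ref_int g = \int[leb]_(y in `[0, 1]) (G (1 - y, y) - G (0, y)).
Proof.
move=> cG cg dG; rewrite /ref_int /Rintegral; congr fine.
have ig : leb2.-integrable setT ((EFin \o g) \_ (ref_triangle : set mplane)).
  apply/(integrable_restrict _ measurable_ref_triangle measurableT).
  by rewrite setTI; exact: integrable_ref.
rewrite integral_mkcond /leb2 -integral21_prod_meas1//.
rewrite (@integral_itv_bndoo _ 0 1 _ true false); last first.
  apply/measurable_EFinP; apply: measurable_funTS; apply: continuous_measurable_fun => y.
  have [_ cB _] := @continuous_side R.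
  apply: cvgB; last exact: continuous_y.
  by apply: (@continuous_comp _ _ _ sideBC G); [exact: cB|exact: cG].
rewrite [RHS]integral_mkcond; apply: eq_integral => y _; rewrite /fubini_G !patchE/=.
case: ifPn => [|/negP]; rewrite inE/= in_itv/=.
  move=> /andP[y0 y1].
  rewrite -(@integral_derivative_oo (fun x => G (x, y)) (fun x => g (x, y)))//;
    last 2 first.
  - by lra.
  - exact: continuous_x.
  rewrite [RHS]integral_mkcond; apply: eq_integral => x _; rewrite !patchE.
  have -> // : ((x, y) \in ref_triangle) = (x \in `]0, 1 - y[%classic).
  apply/idP/idP; rewrite !inE/= in_itv/=.
    by case=> /= *; apply/andP; split; lra.
  by move=> /andP[? ?]; split => /=; lra.
move=> yn; rewrite integral0_eq// => x _; rewrite patchE; case: ifPn => //.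
by rewrite inE => -[/= x0 y0 xy]; case: yn; apply/andP; split; lra.
Qed.

Lemma ref_int_derive_y G g : continuous G -> continuous g ->
  (forall x y : R, is_derive y 1 (fun y => G (x, y)) (g (x, y))) ->
  ref_int g = \int[leb]_(x in `[0, 1]) (G (x, 1 - x) - G (x, 0)).
Proof.
move=> cG cg dG; rewrite /ref_int /Rintegral; congr fine.
have ig : leb2.-integrable setT ((EFin \o g) \_ (ref_triangle : set mplane)).
  apply/(integrable_restrict _ measurable_ref_triangle measurableT).
  by rewrite setTI; exact: integrable_ref.
rewrite integral_mkcond /leb2 -integral12_prod_meas1//.
rewrite (@integral_itv_bndoo _ 0 1 _ true false); last first.
  apply/measurable_EFinP; apply: measurable_funTS; apply: continuous_measurable_fun => x.
  have cd : continuous (fun t : R => (t, 1 - t)).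
    move=> t; apply: (@cvg_pair _ _ _ _ (nbhs _) (nbhs _)); first exact: cvg_id.
    by apply: cvgB; [exact: cvg_cst|exact: cvg_id].
  apply: cvgB; last exact: (continuous_x (f := G)).
  exact: (@continuous_comp _ _ _ (fun t : R => (t, 1 - t)) G x (cd x) (cG _)).
rewrite [RHS]integral_mkcond; apply: eq_integral => x _; rewrite /fubini_F !patchE/=.
case: ifPn => [|/negP]; rewrite inE/= in_itv/=.
  move=> /andP[x0 x1].
  rewrite -(@integral_derivative_oo (fun y => G (x, y)) (fun y => g (x, y)))//;
    last 2 first.
  - by lra.
  - exact: continuous_y.
  rewrite [RHS]integral_mkcond; apply: eq_integral => y _; rewrite !patchE.
  have -> // : ((x, y) \in ref_triangle) = (y \in `]0, 1 - x[%classic).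
  apply/idP/idP; rewrite !inE/= in_itv/=.
    by case=> /= *; apply/andP; split; lra.
  by move=> /andP[? ?]; split => /=; lra.
move=> xn; rewrite integral0_eq// => y _; rewrite patchE; case: ifPn => //.
by rewrite inE => -[/= x0 y0 xy]; case: xn; apply/andP; split; lra.
Qed.

End Slices.

Section TraceIdentity.
Context {R : realType}.
Local Notation mplane := (measurableTypeR R * measurableTypeR R)%type.
Implicit Types (f g W G : R * R -> R) (p v w z : R * R) (S a c alpha : R).

Lemma continuousMp f g : continuous f -> continuous g -> continuous (fun z => f z * g z).
Proof. by move=> cf cg z; apply: cvgM; [exact: cf|exact: cg]. Qed.

Lemma continuousDp f g : continuous f -> continuous g -> continuous (fun z => f z + g z).
Proof. by move=> cf cg z; apply: cvgD; [exact: cf|exact: cg]. Qed.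

Lemma continuousZp k f : continuous f -> continuous (fun z => k * f z).
Proof. by move=> cf; apply: continuousMp => // z; exact: cvg_cst. Qed.

Lemma continuous_fst : continuous (fun z : R * R => z.1).
Proof. by move=> z; exact: cvg_fst. Qed.

Lemma continuous_snd : continuous (fun z : R * R => z.2).
Proof. by move=> z; exact: cvg_snd. Qed.

Lemma continuous_sqr f : continuous f -> continuous (fun z => f z ^+ 2).
Proof. by move=> cf; under eq_fun do rewrite expr2; exact: continuousMp. Qed.

(** The divergence theorem for the field W^2 (x, y), which has divergence
    2 W^2 + 2 W (x W_x + y W_y) and is tangent to the two sides through the
    origin.  Slicing horizontally and vertically gives the integrals over the
    third side with the weights 1 - s and s, which add up to 1. *)
Lemma side_int_BCE W : smooth W ->
  side_int sideBC W =
  ref_int (fun z => 2 * W z ^+ 2 + 2 * (W z * (z.1 * 'D_e1 W z + z.2 * 'D_e2 W z))).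
Proof.
move=> sW; have cW := smooth_continuous sW.
have cX := smooth_continuous (smooth_derive e1 sW).
have cY := smooth_continuous (smooth_derive e2 sW).
have cf := continuous_fst; have cs := continuous_snd.
pose G1 z := z.1 * W z ^+ 2; pose G2 z := z.2 * W z ^+ 2.
pose g1 z := W z ^+ 2 + 2 * (W z * (z.1 * 'D_e1 W z)).
pose g2 z := W z ^+ 2 + 2 * (W z * (z.2 * 'D_e2 W z)).
have cW2 := continuous_sqr cW.
have cG1 : continuous G1 by exact: continuousMp.
have cG2 : continuous G2 by exact: continuousMp.
have cg1 : continuous g1.
  by apply: continuousDp => //; apply: continuousZp; do 2 apply: continuousMp => //.
have cg2 : continuous g2.
  by apply: continuousDp => //; apply: continuousZp; do 2 apply: continuousMp => //.
have d1 (x y : R) : is_derive x 1 (fun x => G1 (x, y)) (g1 (x, y)).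
  have dW := differentiable_derivable_x (smooth_differentiable (x, y) sW).
  have := is_deriveM (is_derive_id x 1) (is_deriveX 2 dW).
  by move=> H; apply: (is_derive_eq H);
    rewrite /g1 /= scaler1 !fctE -![_ *: _]/(_ * _) /=; ring.
have d2 (x y : R) : is_derive y 1 (fun y => G2 (x, y)) (g2 (x, y)).
  have dW := differentiable_derivable_y (smooth_differentiable (x, y) sW).
  have := is_deriveM (is_derive_id y 1) (is_deriveX 2 dW).
  by move=> H; apply: (is_derive_eq H);
    rewrite /g2 /= scaler1 !fctE -![_ *: _]/(_ * _) /=; ring.
transitivity (ref_int (fun z => g1 z + g2 z)); last first.
  by congr ref_int; apply/funext => z; rewrite /g1/g2; ring.
rewrite (ref_intD cg1 cg2) (ref_int_derive_x cG1 cg1 d1) (ref_int_derive_y cG2 cg2 d2).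
have [_ cB _] := @continuous_side R.
have cWB : continuous (fun s : R => W (sideBC s)).
  by move=> s; apply: (@continuous_comp _ _ _ sideBC W); [exact: cB|exact: cW].
pose H1 (s : R) := (1 - s) * W (sideBC s) ^+ 2.
pose H2 (s : R) := s * W (sideBC s) ^+ 2.
have cH1 : continuous H1.
  move=> s; apply: cvgM; first by apply: cvgB; [exact: cvg_cst|exact: cvg_id].
  by apply: cvgM; exact: cWB.
have cH2 : continuous H2.
  by move=> s; apply: cvgM; [exact: cvg_id|apply: cvgM; exact: cWB].
have iH (H : R -> R) : continuous H -> leb.-integrable (`[0, 1]%classic :
  set R) (EFin \o H).
  move=> cH; apply: continuous_compact_integrable; first exact: segment_compact.
  exact: continuous_subspaceT.
have -> : \int[leb]_(y in `[0, 1]) (G1 (1 - y, y) - G1 (0, y))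
  = \int[leb]_(y in `[0, 1]) H1 y.
  by apply: eq_Rintegral => y _; rewrite /G1/H1/sideBC/= mul0r subr0.
have -> : \int[leb]_(x in `[0, 1]) (G2 (x, 1 - x) - G2 (x, 0))
  = \int[leb]_(y in `[0, 1]) H2 y.
  have -> : \int[leb]_(x in `[0, 1]) H2 x = \int[leb]_(x in `[0, 1]) H2 (1 - x).
    rewrite Rintegration_by_substitution_onem ?ler01 ?lexx//.
      by rewrite unstable.onem1.
    exact: continuous_subspaceT.
  by apply: eq_Rintegral => x _; rewrite /G2/H2/sideBC/= mul0r subr0;
    congr (_ * W (_, _) ^+ 2); ring.
rewrite -RintegralD//; [|exact: iH..].
by apply: eq_Rintegral => s _; rewrite /H1/H2; ring.
Qed.

(** Up to a constant factor, the Dirichlet integral of the equilateral triangle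
    in barycentric coordinates. *)
Definition grad_form W := ref_int (fun z =>
  'D_e1 W z ^+ 2 - 'D_e1 W z * 'D_e2 W z + 'D_e2 W z ^+ 2).

(** For constants, equality holds in the limit of [eta] tending to 0.  This
    sharpness of the coefficient 2 is what makes the gradient of an approximate
    minimiser small. *)
Lemma side_int_BC_le W (eta : R) : smooth W -> 0 < eta ->
  side_int sideBC W <= (2 + eta) * mass W + 2 / eta * grad_form W.
Proof.
move=> sW eta0; have cW := smooth_continuous sW.
have cX := smooth_continuous (smooth_derive e1 sW).
have cY := smooth_continuous (smooth_derive e2 sW).
have cf := continuous_fst; have cs := continuous_snd.
have cXY : continuous (fun z => 'D_e1 W z ^+ 2 - 'D_e1 W z * 'D_e2 W z + 'D_e2 W z ^+ 2).
  apply: continuousDp; last exact: continuous_sqr.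
  move=> z; apply: cvgB; [exact: continuous_sqr cX z|exact: continuousMp cX cY z].
rewrite side_int_BCE// /grad_form /mass -!ref_intZ//; last exact: continuous_sqr.
rewrite -ref_intD; [|exact: continuousZp (continuous_sqr cW)|exact: continuousZp].
apply: le_ref_int.
- apply: continuousDp; first exact: continuousZp (continuous_sqr cW).
  by apply: continuousZp; apply: continuousMp => //; apply: continuousDp;
    exact: continuousMp.
- by apply: continuousDp; [exact: continuousZp (continuous_sqr cW)|exact: continuousZp].
- move=> [x y] [/= x0 y0 xy] /=.
  set w := W _; set X := 'D_e1 _ _; set Y := 'D_e2 _ _.
  set q := x * X + y * Y.
  have h1 : 2 * (w * q) <= eta * w ^+ 2 + eta^-1 * q ^+ 2.
    rewrite -subr_ge0.
    have -> : eta * w ^+ 2 + eta^-1 * q ^+ 2 - 2 * (w * q)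
      = eta * (w - eta^-1 * q) ^+ 2 by field; lra.
    by rewrite mulr_ge0 ?sqr_ge0//; lra.
  have h2 : q ^+ 2 <= X ^+ 2 + Y ^+ 2.
    rewrite -subr_ge0.
    have -> : X ^+ 2 + Y ^+ 2 - q ^+ 2 = (1 - x + x * (1 - x - y)) * X ^+ 2
        + (1 - y + y * (1 - x - y)) * Y ^+ 2 + x * y * (X - Y) ^+ 2.
      by rewrite /q; ring.
    have xy0 : 0 <= x * y by rewrite mulr_ge0// ltW.
    have xs : 0 <= x * (1 - x - y) by rewrite mulr_ge0//; lra.
    have ys : 0 <= y * (1 - x - y) by rewrite mulr_ge0//; lra.
    by rewrite !addr_ge0// mulr_ge0 ?sqr_ge0//; lra.
  have h3 : X ^+ 2 + Y ^+ 2 <= 2 * (X ^+ 2 - X * Y + Y ^+ 2).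
    by have := sqr_ge0 (X - Y); nra.
  have e0 : 0 < eta^-1 by rewrite invr_gt0.
  have h4 : eta^-1 * q ^+ 2 <= eta^-1 * (2 * (X ^+ 2 - X * Y + Y ^+ 2)).
    by rewrite ler_pM2l//; exact: le_trans h2 h3.
  rewrite [leRHS](_ : _
    = 2 * w ^+ 2 + eta * w ^+ 2 + eta^-1 * (2 * (X ^+ 2 - X * Y + Y ^+ 2))).
    rewrite -/q; lra.
  ring.
Qed.

End TraceIdentity.

(** * Averaging over the three rotations *)

Section Averaging.
Context {R : realType}.
Implicit Types (f g W G : R * R -> R) (p v w z : R * R) (S a c alpha : R).

Definition int_xx W := ref_int (fun z => 'D_e1 W z ^+ 2).
Definition int_xy W := ref_int (fun z => 'D_e1 W z * 'D_e2 W z).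
Definition int_yy W := ref_int (fun z => 'D_e2 W z ^+ 2).

Lemma ref_int_quad (x y k : R) W : smooth W ->
  ref_int (fun z => x * 'D_e1 W z ^+ 2 + y * ('D_e1 W z * 'D_e2 W z) + k * 'D_e2 W z ^+ 2)
  = x * int_xx W + y * int_xy W + k * int_yy W.
Proof.
move=> sW; have cX := smooth_continuous (smooth_derive e1 sW).
have cY := smooth_continuous (smooth_derive e2 sW).
have c1 := continuous_sqr cX; have c2 := continuousMp cX cY; have c3 := continuous_sqr cY.
have d1 := continuousZp (k := x) c1; have d2 := continuousZp (k := y) c2;
  have d3 := continuousZp (k := k) c3.
rewrite (ref_intD (continuousDp d1 d2) d3) (ref_intD d1 d2).
by congr (_ + _ + _); [exact: ref_intZ c1|exact: ref_intZ c2|exact: ref_intZ c3].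
Qed.

Lemma smooth_derive_pair W (x y : R) z : smooth W ->
  'D_((x, y) : R * R) W z = x * 'D_e1 W z + y * 'D_e2 W z.
Proof.
move=> sW; have := congr1 (@^~ z) (smooth_deriveD e1 e2 x y sW) => /= <-.
apply: (f_equal (fun v : R * R => 'D_v W z)).
by rewrite /e1 /e2; congr (_, _) => /=; rewrite -![_ *: _]/(_ * _); ring.
Qed.

Lemma mass_derive W (x y : R) : smooth W ->
  mass ('D_((x, y) : R * R) W)
    = x ^+ 2 * int_xx W + 2 * x * y * int_xy W + y ^+ 2 * int_yy W.
Proof.
move=> sW; rewrite -ref_int_quad//; congr ref_int; apply/funext => z.
rewrite (smooth_derive_pair x y z sW).
set X := 'D_e1 W _; set Y := 'D_e2 W _; ring.
Qed.

Lemma grad_formE W : smooth W -> grad_form W = int_xx W - int_xy W + int_yy W.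
Proof.
move=> sW; transitivity (1 * int_xx W + (-1) * int_xy W + 1 * int_yy W); last by ring.
rewrite -(ref_int_quad 1 (-1) 1 sW); congr ref_int; apply/funext => z.
set X := 'D_e1 W _; set Y := 'D_e2 W _; ring.
Qed.

Lemma lengths_sqr S a c :
  [/\ lAB c ^+ 2 = 4 * c ^+ 2, lBC S a c ^+ 2 = (a - c) ^+ 2 + (S / c) ^+ 2 &
      lCA S a c ^+ 2 = (a + c) ^+ 2 + (S / c) ^+ 2].
Proof.
rewrite /lAB /lBC /lCA /edge_length !sqr_sqrtr ?addr_ge0 ?sqr_ge0//=.
by split; ring.
Qed.

(** A law-of-cosines form of the Dirichlet integral: each coefficient is
    the square of one side, and the three integrals that they multiply are
    permuted cyclically by [vcycle]. *)
Lemma grad_massE S a c W : 0 < S -> 0 < c -> smooth W ->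
  4 * S ^+ 2 * grad_mass S a c W =
  lCA S a c ^+ 2 * (int_xx W - int_xy W) + lAB c ^+ 2 * (int_yy W - int_xy W)
  + lBC S a c ^+ 2 * int_xy W.
Proof.
move=> S0 c0 sW; rewrite /grad_mass !mass_derive//.
have [-> -> ->] := lengths_sqr S a c.
by field; rewrite ?gt_eqF.
Qed.

Lemma grad_form_ge0 W : smooth W -> 0 <= grad_form W.
Proof.
move=> sW; apply: ref_int_ge0 => z _.
set X := 'D_e1 W z; set Y := 'D_e2 W z.
have := sqr_ge0 X; have := sqr_ge0 Y; have := sqr_ge0 (X - Y); nra.
Qed.

Lemma smooth_vcycle W : smooth W -> smooth (W \o vcycle).
Proof. exact: smooth_affine affine_vcycle. Qed.

Lemma mass_vcycle W : smooth W -> mass (W \o vcycle) = mass W.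
Proof.
by move=> sW; rewrite /mass -[RHS]ref_int_vcycle//; apply: continuous_sqr;
  exact: smooth_continuous.
Qed.

Lemma derive_vcycle W z : smooth W ->
  'D_e1 (W \o vcycle) z = 'D_e2 W (vcycle z) - 'D_e1 W (vcycle z) /\
  'D_e2 (W \o vcycle) z = - 'D_e1 W (vcycle z).
Proof.
move=> sW.
have -> : 'D_e1 (W \o vcycle) z = 'D_((- (@e1 R).1 - (@e1 R).2, (@e1 R).1) :
  R * R) W (vcycle z).
  exact: (congr1 (@^~ z) (derive_affine _ _ affine_vcycle)).
have -> : 'D_e2 (W \o vcycle) z = 'D_((- (@e2 R).1 - (@e2 R).2, (@e2 R).1) :
  R * R) W (vcycle z).
  exact: (congr1 (@^~ z) (derive_affine _ _ affine_vcycle)).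
rewrite (smooth_derive_pair (- (@e1 R).1 - (@e1 R).2) (@e1 R).1 _ sW).
rewrite (smooth_derive_pair (- (@e2 R).1 - (@e2 R).2) (@e2 R).1 _ sW).
set X := 'D_e1 W _; set Y := 'D_e2 W _.
by rewrite /e1 /e2 /=; split; ring.
Qed.

Lemma int_vcycle W : smooth W ->
  [/\ int_xx (W \o vcycle) = int_yy W - 2 * int_xy W + int_xx W,
      int_xy (W \o vcycle) = int_xx W - int_xy W &
      int_yy (W \o vcycle) = int_xx W].
Proof.
move=> sW.
have cX := smooth_continuous (smooth_derive e1 sW).
have cY := smooth_continuous (smooth_derive e2 sW).
have Q (x y k : R) (h : R * R -> R) :
    (forall z, h z = x * 'D_e1 W (vcycle z) ^+ 2
      + y * ('D_e1 W (vcycle z) * 'D_e2 W (vcycle z))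
       + k * 'D_e2 W (vcycle z) ^+ 2) ->
    ref_int h = x * int_xx W + y * int_xy W + k * int_yy W.
  move=> hE; rewrite -ref_int_quad//.
  have d1 := continuousZp (k := x) (continuous_sqr cX);
    have d2 := continuousZp (k := y) (continuousMp cX cY).
  have d3 := continuousZp (k := k) (continuous_sqr cY).
  rewrite -(ref_int_vcycle (continuousDp (continuousDp d1 d2) d3)).
  by congr ref_int; apply/funext.
rewrite [int_xx (_ \o _)]/int_xx [int_xy (_ \o _)]/int_xy [int_yy (_ \o _)]/int_yy.
split.
- rewrite (Q 1 (-2) 1) => [|z]; first by ring.
  have [-> _] := derive_vcycle z sW.
  set X := 'D_e1 W _; set Y := 'D_e2 W _; ring.
- rewrite (Q 1 (-1) 0) => [|z]; first by ring.
  have [-> ->] := derive_vcycle z sW.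
  set X := 'D_e1 W _; set Y := 'D_e2 W _; ring.
- rewrite (Q 1 0 0) => [|z]; first by ring.
  have [_ ->] := derive_vcycle z sW.
  set X := 'D_e1 W _; set Y := 'D_e2 W _; ring.
Qed.

Lemma grad_form_vcycle W : smooth W -> grad_form (W \o vcycle) = grad_form W.
Proof.
move=> sW; rewrite (grad_formE (smooth_vcycle sW)) (grad_formE sW).
by have [-> -> ->] := int_vcycle sW; ring.
Qed.

Lemma side_int_vcycle W :
  [/\ side_int sideAB (W \o vcycle) = side_int sideBC W,
      side_int sideBC (W \o vcycle) = side_int sideCA W &
      side_int sideCA (W \o vcycle) = side_int sideAB W].
Proof.
by split; apply: eq_Rintegral => s _; rewrite /= /sideAB/sideBC/sideCA/vcycle/=;
   congr (W (_, _) ^+ 2); ring.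
Qed.

Definition side_sum W := side_int sideAB W + side_int sideBC W + side_int sideCA W.

Lemma side_sum_le W (eta : R) : smooth W -> 0 < eta ->
  side_sum W <= 3 * ((2 + eta) * mass W + 2 / eta * grad_form W).
Proof.
move=> sW eta0; have sW1 := smooth_vcycle sW; have sW2 := smooth_vcycle sW1.
have := side_int_BC_le sW eta0; have := side_int_BC_le sW1 eta0;
  have := side_int_BC_le sW2 eta0.
have [_ -> _] := side_int_vcycle (W \o vcycle).
have [_ -> ->] := side_int_vcycle W.
rewrite !(mass_vcycle, grad_form_vcycle)// /side_sum; lra.
Qed.

(** Composition with [vcycle] permutes cyclically both the three integrals of
    [grad_massE] and the three side integrals, so that in the sum each of them
    meets every side of the triangle once. *)
Lemma energy_sum S a c alpha W : 0 < S -> 0 < c -> smooth W ->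
  energy S a c alpha W + energy S a c alpha (W \o vcycle)
    + energy S a c alpha (W \o vcycle \o vcycle) =
  (lAB c ^+ 2 + lBC S a c ^+ 2 + lCA S a c ^+ 2) / (2 * S) * grad_form W
   + alpha * (lAB c + lBC S a c + lCA S a c) * side_sum W.
Proof.
move=> S0 c0 sW; have sW1 := smooth_vcycle sW; have sW2 := smooth_vcycle sW1.
have gm V : smooth V -> grad_mass S a c V
  = (lCA S a c ^+ 2 * (int_xx V - int_xy V) + lAB c ^+ 2 * (int_yy V - int_xy V)
  + lBC S a c ^+ 2 * int_xy V) / (4 * S ^+ 2).
  by move=> sV; rewrite -grad_massE//; field; rewrite gt_eqF.
rewrite /energy !gm// /bd_mass /side_sum (grad_formE sW).
have [-> -> ->] := side_int_vcycle (W \o vcycle).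
have [-> -> ->] := side_int_vcycle W.
have [-> -> ->] := int_vcycle sW1.
have [-> -> ->] := int_vcycle sW.
by field; rewrite gt_eqF.
Qed.

(** The three rotated functions have the same mass, and one of them has at most
    the mean energy. *)
Lemma lambda_tri_le_avg S a c alpha W : 0 < S -> 0 < c -> smooth W -> 0 < mass W ->
  (lambda_tri S alpha a c <=
   (((lAB c ^+ 2 + lBC S a c ^+ 2 + lCA S a c ^+ 2) / (6 * S) * grad_form W
     + alpha * ((lAB c + lBC S a c + lCA S a c) / 3) * side_sum W)
    / (2 * S * mass W))%R%:E)%E.
Proof.
move=> S0 c0 sW m0; have sW1 := smooth_vcycle sW; have sW2 := smooth_vcycle sW1.
have m1 : 0 < 2 * S * mass W by rewrite !mulr_gt0.
have := energy_sum a alpha S0 c0 sW.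
set E0 := energy _ _ _ _ W; set E1 := energy _ _ _ _ (W \o _); set E2 := energy _ _ _ _ _.
set T := _ / (2 * S) * _ + _ => ET.
have -> : (lAB c ^+ 2 + lBC S a c ^+ 2 + lCA S a c ^+ 2) / (6 * S) * grad_form W
     + alpha * ((lAB c + lBC S a c + lCA S a c) / 3) * side_sum W = T / 3.
  by rewrite /T; field; rewrite gt_eqF.
have key V E : smooth V -> mass V = mass W -> E = energy S a c alpha V -> E <= T / 3 ->
    (lambda_tri S alpha a c <= (T / 3 / (2 * S * mass W))%:E)%E.
  move=> sV mV EV ET3; have mV0 : 0 < mass V by rewrite mV.
  apply: le_trans (lambda_tri_le a alpha S0 c0 sV mV0) _.
  by move: ET3; rewrite EV lee_fin mV ler_pM2r ?invr_gt0.
have [h0|h0] := leP E0 (T / 3); first exact: key sW erefl erefl h0.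
have [h1|h1] := leP E1 (T / 3); first exact: key sW1 (mass_vcycle sW) erefl h1.
have [h2|h2] := leP E2 (T / 3).
  exact: key sW2 (etrans (mass_vcycle sW1) (mass_vcycle sW)) erefl h2.
by exfalso; lra.
Qed.

End Averaging.

(** * Side lengths near the equilateral triangle *)

Section Lengths.
Context {R : realType}.
Implicit Types (W : R * R -> R) (S a c alpha : R).

Lemma lengths_ge0 S a c : [/\ 0 <= lAB c, 0 <= lBC S a c & 0 <= lCA S a c].
Proof. by split; exact: sqrtr_ge0. Qed.

(** The left side is 6 c^2 + 2 a^2 + 6 r^4 / c^2, which has a critical point at
    a = 0, c = r. *)
Lemma sum_lengths_sqr_le S r a c : 0 < r -> S ^+ 2 = 3 * r ^+ 4 ->
  `|a| + `|c - r| < r / 4 ->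
  lAB c ^+ 2 + lBC S a c ^+ 2 + lCA S a c ^+ 2
    <= 12 * r ^+ 2 + 54 * (a ^+ 2 + (c - r) ^+ 2).
Proof.
move=> r0 Sr hac; have [-> -> ->] := lengths_sqr S a c.
have := ler_norm (- (c - r)); rewrite normrN => h1; have := normr_ge0 a => h2.
have c2 : r / 2 < c by lra.
have c0 : 0 < c by lra.
rewrite exprMn exprVn Sr -subr_ge0.
have -> : 12 * r ^+ 2 + 54 * (a ^+ 2 + (c - r) ^+ 2) -
   (4 * c ^+ 2 + ((a - c) ^+ 2 + 3 * r ^+ 4 * (c ^+ 2)^-1) + ((a + c) ^+ 2
     + 3 * r ^+ 4 * (c ^+ 2)^-1))
   = 52 * a ^+ 2 + 6 * (c - r) ^+ 2 * ((2 * c - r) * (4 * c + r)) / c ^+ 2.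
  by field; rewrite gt_eqF.
have k0 : 0 <= (2 * c - r) * (4 * c + r) by rewrite mulr_ge0//; lra.
apply: addr_ge0; first by rewrite mulr_ge0// sqr_ge0.
by apply: divr_ge0; [apply: mulr_ge0 => //; rewrite mulr_ge0// sqr_ge0|exact: sqr_ge0].
Qed.

(** Let p and q be the two sides other than AB.  Since T = (S / c)^2 is at least
    c^2, one has p q >= c^2 + T, hence (p + q)^2 >= 4 (c^2 + T) + 2 a^2.  The
    function 4 (c^2 + T) exceeds (6 r - 2 c)^2 by
    12 r (c - r)^2 (2 c + r) / c^2, which is at least 12 (c - r)^2.  Hence
    (p + q)^2 exceeds (6 r - 2 c)^2 by at least 2 h with h = a^2 + (c - r)^2,
    and this is more than (6 r - 2 c + h / (12 r))^2 does. *)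
Lemma perimeter_ge S r a c : 0 < r -> S ^+ 2 = 3 * r ^+ 4 ->
  `|a| + `|c - r| < r / 4 ->
  6 * r + (a ^+ 2 + (c - r) ^+ 2) / (12 * r) <= lAB c + lBC S a c + lCA S a c.
Proof.
move=> r0 Sr hac; have [h1 h2 h3] := lengths_sqr S a c.
have [p0 q0 s0] := lengths_ge0 S a c.
have := ler_norm (- (c - r)); have := ler_norm (c - r); rewrite normrN => n1 n2.
have n3 := normr_ge0 a.
have c2 : r / 2 < c by lra.
have c3 : c < 5 / 4 * r by lra.
have c0 : 0 < c by lra.
have AB : lAB c = 2 * c.
  by apply/eqP; rewrite -(@eqrXn2 _ 2)//; [rewrite h1; apply/eqP; ring|lra].
rewrite AB; move: h2 h3 q0 s0; set p := lBC _ _ _; set q := lCA _ _ _.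
set T := (S / c) ^+ 2 => hp hq p1 q1.
have TE : T * c ^+ 2
  = 3 * r ^+ 4 by rewrite /T exprMn exprVn Sr divfK// expf_neq0 ?gt_eqF.
have c4 : 0 < c ^+ 2 by rewrite exprn_gt0.
have cT : c ^+ 2 <= T.
  rewrite -(ler_pM2r c4) TE.
  have : c ^+ 2 <= (5 / 4 * r) ^+ 2 by rewrite lerXn2r ?nnegrE//; lra.
  move=> cr; have : c ^+ 2 * c ^+ 2 <= (5 / 4 * r) ^+ 2 * (5 / 4 * r) ^+ 2.
    by apply: ler_pM => //; exact: ltW.
  have r4 : 0 < r ^+ 4 by rewrite exprn_gt0.
  have -> : (5 / 4 * r) ^+ 2 * (5 / 4 * r) ^+ 2 = 625 / 256 * r ^+ 4 by field.
  lra.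
have pq : c ^+ 2 + T <= p * q.
  have T0 : 0 <= T by rewrite sqr_ge0.
  rewrite -(@ler_pXn2r _ 2%N) ?nnegrE ?mulr_ge0 ?addr_ge0 ?sqr_ge0//.
  rewrite exprMn hp hq -subr_ge0.
  have -> : ((a - c) ^+ 2 + T) * ((a + c) ^+ 2 + T) - (c ^+ 2 + T) ^+ 2
     = a ^+ 2 * (a ^+ 2 + 2 * (T - c ^+ 2)) by ring.
  by rewrite mulr_ge0 ?sqr_ge0// addr_ge0 ?sqr_ge0//; lra.
set h := a ^+ 2 + (c - r) ^+ 2.
have h0 : 0 <= h by rewrite addr_ge0 ?sqr_ge0.
have hr : h <= r ^+ 2 / 16.
  have : h <= (`|a| + `|c - r|) ^+ 2.
    have := real_normK (num_real a); have := real_normK (num_real (c - r)).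
    rewrite /h => <- <-; have : 0 <= `|a| * `|c - r| by rewrite mulr_ge0.
    by move: `|a| `|c - r| => A B *; lra.
  move=> /le_trans; apply.
  have -> : r ^+ 2 / 16 = (r / 4) ^+ 2 by field.
  by rewrite lerXn2r ?nnegrE ?addr_ge0//; lra.
set k := h / (12 * r).
have kE : 12 * r * k = h by rewrite /k mulrC divfK// gt_eqF//; lra.
have k0 : 0 <= k by rewrite divr_ge0//; lra.
have TB : 36 * r ^+ 2 - 24 * r * c + 12 * (c - r) ^+ 2 <= 4 * T.
  have E : 4 * T * c ^+ 2 = 4 * (3 * r ^+ 4) by rewrite -TE; ring.
  rewrite -(ler_pM2r c4) E -subr_ge0.
  have -> : 4 * (3 * r ^+ 4) - (36 * r ^+ 2 - 24 * r * c + 12 * (c - r) ^+ 2) * c ^+ 2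
    = 12 * (c - r) ^+ 2 * (r * (2 * c + r) - c ^+ 2) by ring.
  have c5 : 0 <= c * (2 * r - c) by rewrite mulr_ge0//; lra.
  apply: mulr_ge0; first by rewrite mulr_ge0// sqr_ge0.
  by have := sqr_ge0 r; lra.
suff : 6 * r - 2 * c + k <= p + q by lra.
have Y0 : 0 <= 6 * r - 2 * c + k by lra.
have pq0 : 0 <= p + q by exact: addr_ge0.
rewrite -(@ler_pXn2r _ 2%N) ?nnegrE//.
have -> : (p + q) ^+ 2 = p ^+ 2 + q ^+ 2 + 2 * (p * q) by ring.
rewrite hp hq.
have kk : k ^+ 2 <= h / 144.
  have : (12 * r * k) * (12 * r * k) <= h * (r ^+ 2 / 16).
    by rewrite kE; apply: ler_pM => //; rewrite kE.
  have r2 : 0 < r ^+ 2 by rewrite exprn_gt0.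
  move=> H; rewrite -(ler_pM2l r2); nra.
have kc : 0 <= k * c by rewrite mulr_ge0// ltW.
have := sqr_ge0 a; have := sqr_ge0 (c - r).
move: kk kE TB pq; rewrite /h; clear -kc; move=> *. nra.
Qed.

End Lengths.

(** * Comparison of the energies *)

Section Estimates.
Context {R : realType}.
Implicit Types (W : R * R -> R) (S a c alpha beta r : R).

(** [b] plays the part of the sum of the side integrals, [g] of the gradient
    form, [m] of the mass, and [beta] of - alpha.  The first bound on [b] is the
    trace inequality with its parameter chosen to absorb half of the gradient
    term; inserted into the hypothesis on the energy, it cancels the terms of
    order [beta]. *)
Lemma gradient_small S r beta (g b m : R) : 0 < S -> 0 < r -> S ^+ 2 = 3 * r ^+ 4 ->
  0 < beta -> 0 < m -> 0 <= g ->
  b <= (6 + 36 * (S * beta / r)) * m + r / (2 * S * beta) * g ->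
  2 * r ^+ 2 / S * g - 2 * r * beta * b
    <= (- 6 * r * beta / S + beta ^+ 2) * (2 * S * m) ->
  g <= 222 * r ^+ 2 * beta ^+ 2 * m /\ (6 - S * beta / r) * m <= b.
Proof.
move=> S0 r0 Sr b0 m0 g0 hb hq.
have E1 : (- 6 * r * beta / S + beta ^+ 2) * (2 * S * m)
  = - 12 * r * beta * m + 2 * S * beta ^+ 2 * m.
  by field; rewrite gt_eqF.
rewrite E1 in hq.
have rb : 0 < 2 * r * beta by rewrite !mulr_gt0.
have hb2 : 2 * r * beta * b
  <= 12 * r * beta * m + 72 * S * beta ^+ 2 * m + r ^+ 2 / S * g.
  have := hb; rewrite -(ler_pM2l rb).
  have -> // : 2 * r * beta * ((6 + 36 * (S * beta / r)) * m
    + r / (2 * S * beta) * g)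
        = 12 * r * beta * m + 72 * S * beta ^+ 2 * m + r ^+ 2 / S * g.
  by field; rewrite ?gt_eqF.
have rS : 0 < r ^+ 2 / S by rewrite divr_gt0 ?exprn_gt0.
split.
  rewrite -(ler_pM2l rS).
  have -> : r ^+ 2 / S * (222 * r ^+ 2 * beta ^+ 2 * m) = 74 * S * beta ^+ 2 * m.
    have -> : 74 * S * beta ^+ 2 * m = 74 * (S ^+ 2) * beta ^+ 2 * m / S by field;
      rewrite gt_eqF.
    by rewrite Sr; field; rewrite gt_eqF.
  have e : 2 * r ^+ 2 / S * g = 2 * (r ^+ 2 / S * g) by ring.
  rewrite e in hq.
  lra.
rewrite -(ler_pM2l rb).
have -> : 2 * r * beta * ((6 - S * beta / r) * m)
  = 12 * r * beta * m - 2 * S * beta ^+ 2 * m.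
  by field; rewrite gt_eqF.
have : 0 <= 2 * r ^+ 2 / S * g by rewrite mulr_ge0// divr_ge0// ?mulr_ge0 ?sqr_ge0// ltW.
lra.
Qed.

(** [L2] and [L] stand for the sum of the squared sides and the perimeter.  The
    loss is at most 9 h g / S = O(beta^2 h m), the gain at least
    beta h b / (36 r), hence at least beta h m / (12 r); the last upper bound on
    [beta] makes the loss at most half of the gain (216 is 9 times 24). *)
Lemma energy_gain S r beta (g b m L2 L h : R) : 0 < S -> 0 < r -> S ^+ 2 = 3 * r ^+ 4 ->
  0 < beta -> beta <= 3 * r / S -> beta <= S / (216 * (222 * r ^+ 3)) ->
  0 < m -> 0 <= g -> 0 <= h ->
  L2 <= 12 * r ^+ 2 + 54 * h -> 6 * r + h / (12 * r) <= L ->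
  g <= 222 * r ^+ 2 * beta ^+ 2 * m -> (6 - S * beta / r) * m <= b ->
  L2 / (6 * S) * g - beta * (L / 3) * b <=
  2 * r ^+ 2 / S * g - 2 * r * beta * b - 2 * S * m * (beta / (48 * r * S) * h).
Proof.
move=> S0 r0 Sr be0 be1 be2 m0 g0 h0 hL2 hL hg hb.
have sb : S * beta / r <= 3.
  by rewrite ler_pdivrMr// mulrC -ler_pdivlMr.
have b3 : 3 * m <= b by apply: le_trans hb; rewrite ler_pM2r//; lra.
have t1 : L2 / (6 * S) * g
  <= 2 * r ^+ 2 / S * g + 9 * h / S * (222 * r ^+ 2 * beta ^+ 2 * m).
  have : L2 / (6 * S) * g <= (12 * r ^+ 2 + 54 * h) / (6 * S) * g.
    by rewrite ler_wpM2r// ler_pM2r// invr_gt0 mulr_gt0.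
  move=> /le_trans; apply.
  have -> : (12 * r ^+ 2 + 54 * h) / (6 * S) * g = 2 * r ^+ 2 / S * g + 9 * h / S * g.
    by field; rewrite gt_eqF.
  by rewrite lerD2l ler_wpM2l// divr_ge0// ?mulr_ge0// ltW.
have t2 : 2 * r * beta * b + beta * (h / (36 * r)) * (3 * m) <= beta * (L / 3) * b.
  have bb : 0 <= b by apply: le_trans b3; rewrite mulr_ge0// ltW.
  have : beta * ((6 * r + h / (12 * r)) / 3) * b <= beta * (L / 3) * b.
    by apply: ler_wpM2r => //; apply: ler_wpM2l; [exact: ltW|rewrite ler_pM2r].
  apply: le_trans.
  have -> : beta * ((6 * r + h / (12 * r)) / 3) * b
    = 2 * r * beta * b + beta * (h / (36 * r)) * b.
    by field; rewrite gt_eqF.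
  rewrite lerD2l; apply: ler_wpM2l => //; apply: mulr_ge0; first exact: ltW.
  by apply: divr_ge0 => //; rewrite mulr_ge0// ltW.
have t3 : 9 * h / S * (222 * r ^+ 2 * beta ^+ 2 * m) <= beta * (h / (24 * r)) * m.
  have -> : 9 * h / S * (222 * r ^+ 2 * beta ^+ 2 * m)
    = beta * h * m * (9 * (222 * r ^+ 2) / S) * beta.
    by field; rewrite gt_eqF.
  have -> : beta * (h / (24 * r)) * m
    = beta * h * m * (9 * (222 * r ^+ 2) / S) * (S / (216 * (222 * r ^+ 3))).
    by field; rewrite ?gt_eqF.
  apply: ler_wpM2l; last exact: be2.
  apply: mulr_ge0; first by rewrite !mulr_ge0// ltW.
  apply: divr_ge0; last exact: ltW.
  by apply: mulr_ge0; [exact: ler0n|apply: mulr_ge0; [exact: ler0n|exact: sqr_ge0]].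
have t4 : 2 * S * m * (beta / (48 * r * S) * h) = beta * (h / (24 * r)) * m.
  by field; rewrite ?gt_eqF.
have t5 : beta * (h / (36 * r)) * (3 * m) = 2 * (beta * (h / (24 * r)) * m).
  by field; rewrite ?gt_eqF.
rewrite t5 in t2; rewrite t4.
move: t1 t2 t3.
set A := beta * (h / (24 * r)) * m; set B := 9 * h / S * _; set E := L2 / (6 * S) * g.
set Y := beta * (L / 3) * b; set X := 2 * r * beta * b; set G := 2 * r ^+ 2 / S * g.
clear; lra.
Qed.

End Estimates.

(** * The equilateral triangle *)

Section Equilateral.
Context {R : realType}.
Implicit Types (W : R * R -> R) (S a c alpha beta r : R).

Lemma c0_gt0 S : 0 < S -> 0 < c0 S.
Proof. by move=> S0; rewrite sqrtr_gt0 divr_gt0// sqrtr_gt0. Qed.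

Lemma c0_pow4 S : 0 < S -> S ^+ 2 = 3 * c0 S ^+ 4.
Proof.
move=> S0; have s3 : 0 < Num.sqrt (3 : R) by rewrite sqrtr_gt0.
have -> : c0 S ^+ 4 = (c0 S ^+ 2) ^+ 2 by rewrite -exprM.
rewrite sqr_sqrtr ?divr_ge0// ?ltW// exprMn exprVn sqr_sqrtr//.
by field.
Qed.

Lemma equilateral_lengths S r : 0 < r -> S ^+ 2 = 3 * r ^+ 4 ->
  [/\ lAB r = 2 * r, lBC S 0 r = 2 * r & lCA S 0 r = 2 * r].
Proof.
move=> r0 Sr; have [h1 h2 h3] := lengths_sqr S 0 r; have [p1 p2 p3] := lengths_ge0 S 0 r.
have Tr : (S / r) ^+ 2 = 3 * r ^+ 2 by rewrite exprMn exprVn Sr; field; rewrite gt_eqF.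
by split; apply/eqP; rewrite -(@eqrXn2 _ 2)//; rewrite ?h1 ?h2 ?h3 ?Tr; try lra;
  apply/eqP; ring.
Qed.

Lemma equilateral_energy S r alpha W :
  0 < S -> 0 < r -> S ^+ 2 = 3 * r ^+ 4 -> smooth W ->
  energy S 0 r alpha W = 2 * r ^+ 2 / S * grad_form W + alpha * (2 * r * side_sum W).
Proof.
move=> S0 r0 Sr sW; have [e1 e2 e3] := equilateral_lengths r0 Sr.
rewrite /energy /bd_mass /side_sum (grad_formE sW).
have -> : grad_mass S 0 r W = (4 * S ^+ 2 * grad_mass S 0 r W) / (4 * S ^+ 2).
  by field; rewrite gt_eqF.
rewrite grad_massE// e1 e2 e3.
by field; rewrite gt_eqF.
Qed.

Lemma side_sum_le_equilateral S r beta W : 0 < S -> 0 < r -> 0 < beta -> smooth W ->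
  side_sum W <= (6 + 36 * (S * beta / r)) * mass W + r / (2 * S * beta) * grad_form W.
Proof.
move=> S0 r0 b0 sW; have eta0 : 0 < 12 * S * beta / r by rewrite divr_gt0// !mulr_gt0.
apply: le_trans (side_sum_le sW eta0) _; rewrite le_eqVlt; apply/orP; left; apply/eqP.
by field; rewrite ?gt_eqF.
Qed.

(** The bound - 6 r beta / S + beta^2 on the energy is the quotient of the
    constant function plus beta^2: this margin leaves room for approximate
    minimisers and is of the same order as the bound on the gradient. *)
Lemma lambda_tri_le_equilateral S r a c beta W : 0 < S -> 0 < r -> S ^+ 2 = 3 * r ^+ 4 ->
  0 < beta -> beta <= 3 * r / S -> beta <= S / (216 * (222 * r ^+ 3)) ->
  `|a| + `|c - r| < r / 4 -> smooth W -> 0 < mass W ->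
  energy S 0 r (- beta) W / (2 * S * mass W) <= - 6 * r * beta / S + beta ^+ 2 ->
  (lambda_tri S (- beta) a c <= (energy S 0 r (- beta) W / (2 * S * mass W)
     - beta / (48 * r * S) * (a ^+ 2 + (c - r) ^+ 2))%R%:E)%E.
Proof.
move=> S0 r0 Sr be0 be1 be2 hac sW m0; rewrite equilateral_energy//.
have M0 : 0 < 2 * S * mass W by rewrite !mulr_gt0.
have c0 : 0 < c.
  have := ler_norm (- (c - r)); have := normr_ge0 a; rewrite normrN; lra.
rewrite ler_pdivrMr// => hq.
have [] := gradient_small S0 r0 Sr be0 m0 (grad_form_ge0 sW) (side_sum_le_equilateral
  S0 r0 be0 sW).
  by apply: le_trans hq; rewrite le_eqVlt; apply/orP; left; apply/eqP; ring.
move=> hg hb.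
have h0 : 0 <= a ^+ 2 + (c - r) ^+ 2 by rewrite addr_ge0 ?sqr_ge0.
apply: le_trans (lambda_tri_le_avg a (- beta) S0 c0 sW m0) _;
  rewrite lee_fin ler_pdivrMr//.
have := energy_gain S0 r0 Sr be0 be1 be2 m0 (grad_form_ge0 sW) h0
  (sum_lengths_sqr_le r0 Sr hac) (perimeter_ge r0 Sr hac) hg hb.
rewrite mulrBl divfK ?gt_eqF// !mulNr => /le_trans; apply.
by rewrite le_eqVlt; apply/orP; left; apply/eqP; ring.
Qed.

(** The mass of the constant 1 is the area 1/2 of the reference triangle, read
    off from [side_int_BCE]. *)
Lemma constant_trial S r alpha : 0 < S -> 0 < r -> S ^+ 2 = 3 * r ^+ 4 ->
  let W : R * R -> R := cst 1 in
  [/\ smooth W, 0 < mass W & energy S 0 r alpha W / (2 * S * mass W) = 6 * r * alpha / S].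
Proof.
move=> S0 r0 Sr W; have sW : smooth W := smooth_cst 1.
have D v z : 'D_v W z = 0 by exact: derive_cst.
have side e : side_int e W = 1.
  rewrite /side_int; under eq_Rintegral do rewrite /W /= expr1n.
  rewrite Rintegral_cst; last exact: measurable_itv.
  have L1 : lebesgue_measure (`[0%R, 1%R]%classic : set R) = 1%:E.
    by rewrite lebesgue_measure_itv/= lte_fin ltr01 oppr0 adde0.
  by rewrite mul1r; exact: (congr1 fine L1).
have mW : mass W = 1 / 2.
  have := side_int_BCE sW; rewrite side.
  have -> : ref_int (fun z =>
    2 * W z ^+ 2 + 2 * (W z * (z.1 * 'D_e1 W z + z.2 * 'D_e2 W z))) = 2 * mass W.
    rewrite -ref_intZ; last by apply: continuous_sqr; exact: smooth_continuous.
    by congr ref_int; apply/funext => z; rewrite !D !mulr0 addr0 !mulr0 addr0.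
  by move=> E; lra.
split => //; first by rewrite mW; lra.
rewrite equilateral_energy// mW /side_sum !side.
have -> : grad_form W = 0.
  rewrite /grad_form /ref_int; under eq_Rintegral do rewrite !D expr0n mulr0 subr0 addr0.
  by rewrite Rintegral_cst ?mul0r//; exact: measurable_ref_triangle.
by field; rewrite gt_eqF.
Qed.

End Equilateral.

(** * The eigenvalue gap *)

Section Gap.
Context {R : realType}.
Implicit Types (W : R * R -> R) (S a c alpha beta r : R).

(** If the quotient of a competitor is less than [beta ^+ 2] above that of the
    constant function, transplant its smooth approximations; otherwise
    transplant the constant function itself, which does better. *)
Lemma lambda_tri_gap S r a c beta : 0 < S -> 0 < r -> S ^+ 2 = 3 * r ^+ 4 ->
  0 < beta -> beta <= 3 * r / S -> beta <= S / (216 * (222 * r ^+ 3)) ->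
  `|a| + `|c - r| < r / 4 ->
  (lambda_tri S (- beta) a c <= lambda_tri S (- beta) 0%R r
     - (beta / (48 * r * S) * (a ^+ 2 + (c - r) ^+ 2))%:E)%E.
Proof.
move=> S0 r0 Sr be0 be1 be2 hac; set k := (_ * _)%R.
rewrite leeBrDr//; apply: le_ereal_inf_tmp => _ [u [gx [gy [t [Hu nae tr ->]]]]].
rewrite -leeBrDr//; set q := robin_quotient _ _ _ _ _ _ _.
set qc := - 6 * r * beta / S.
have [hq|hq] := ltP q (qc + beta ^+ 2); last first.
  have [sW mW EW] := constant_trial (- beta) S0 r0 Sr.
  have Eqc : 6 * r * - beta / S = qc by rewrite /qc; field; rewrite gt_eqF.
  apply: le_trans (lambda_tri_le_equilateral S0 r0 Sr be0 be1 be2 hac sW mW _) _.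
    by rewrite EW Eqc lerDl sqr_ge0.
  rewrite EW Eqc -EFinB lee_fin lerD2r (le_trans _ hq)// lerDl sqr_ge0//.
apply/lee_addgt0Pr => e e0.
pose e' := Num.min e (qc + beta ^+ 2 - q).
have e'0 : 0 < e' by rewrite lt_min e0 subr_gt0.
have e'1 : e' <= e by rewrite ge_min lexx.
have e'2 : e' <= qc + beta ^+ 2 - q by rewrite ge_min lexx orbT.
have [W [sW mW QW]] := smooth_approx_quotient (- beta) S0 r0 e'0 Hu nae tr.
apply: le_trans (lambda_tri_le_equilateral S0 r0 Sr be0 be1 be2 hac sW mW _) _.
  by apply: le_trans QW _; rewrite -/q -/qc; lra.
rewrite -EFinB -EFinD lee_fin -/k; move: QW; rewrite -/q; lra.
Qed.

(** The trace inequality bounds the boundary term by the mass and the gradient,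
    so that the infimum is not -oo; this is what makes the maximum
    strict. *)
Lemma lambda_tri_fin_num S r beta : 0 < S -> 0 < r -> S ^+ 2 = 3 * r ^+ 4 ->
  0 < beta -> lambda_tri S (- beta) 0 r \is a fin_num.
Proof.
move=> S0 r0 Sr be0.
have [sW mW _] := constant_trial (- beta) S0 r0 Sr.
rewrite fin_numElt; apply/andP; split; last first.
  by apply: le_lt_trans (lambda_tri_le 0 (- beta) S0 r0 sW mW) _; rewrite ltry.
pose B := - (r * beta * (6 + 36 * (S * beta / r)) / S).
apply: lt_le_trans (ltNyr B) _;
  apply: le_ereal_inf_tmp => _ [u [gx [gy [t [Hu nae tr ->]]]]].
apply/lee_addgt0Pr => e e0; rewrite -EFinD lee_fin.
have [W [{}sW {}mW QW]] := smooth_approx_quotient (- beta) S0 r0 e0 Hu nae tr.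
apply: le_trans QW; rewrite equilateral_energy//.
have M0 : 0 < 2 * S * mass W by rewrite !mulr_gt0.
rewrite ler_pdivlMr//.
have := side_sum_le_equilateral S0 r0 be0 sW; have := grad_form_ge0 sW.
set g := grad_form W; set b := side_sum W; set m := mass W => g0 hb.
have rb : 0 < 2 * r * beta by rewrite !mulr_gt0.
have := hb; rewrite -(ler_pM2l rb).
have -> : 2 * r * beta * ((6 + 36 * (S * beta / r)) * m + r / (2 * S * beta) * g)
  = - (B * (2 * S * m)) + r ^+ 2 / S * g.
  by rewrite /B; field; rewrite ?gt_eqF.
have rS : 0 <= r ^+ 2 / S * g by rewrite mulr_ge0// divr_ge0 ?sqr_ge0// ltW.
have -> : 2 * r ^+ 2 / S * g = 2 * (r ^+ 2 / S * g) by ring.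
by move: (B * _) => X; lra.
Qed.

End Gap.

Theorem theorem3p1 (R : realType) (S : R) (hS : 0 < S) :
  exists alpha0 : R, alpha0 < 0 /\
    forall alpha : R, alpha0 <= alpha -> alpha < 0 ->
      strict_local_maximiser S alpha /\
      exists eps C : R, [/\ 0 < eps, 0 < C &
        forall a c : R, 0 < c -> `|a| + `|c - c0 S| < eps ->
          (lambda_tri S alpha a c <=
             lambda_tri S alpha 0%R (c0 S)
               - (C * (a ^+ 2 + (c - c0 S) ^+ 2))%:E)%E].
Proof.
have r0 := c0_gt0 hS; have Sr := c0_pow4 hS.
pose r := c0 S; rewrite -/r in r0 Sr *.
(* The two smallness conditions on [beta] in [energy_gain]. *)
pose b1 := 3 * r / S; pose b2 := S / (216 * (222 * r ^+ 3)).
have b10 : 0 < b1 by rewrite divr_gt0// mulr_gt0.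
have b20 : 0 < b2.
  apply: divr_gt0; first exact: hS.
  apply: mulr_gt0; first exact: ltr0n.
  by apply: mulr_gt0; [exact: ltr0n|exact: exprn_gt0].
exists (- Num.min b1 b2); split; first by rewrite oppr_lt0 lt_min b10.
move=> alpha ha alpha0; rewrite -(opprK alpha); move: ha; rewrite lerNl le_min => /andP[].
have : 0 < - alpha by rewrite oppr_gt0.
move: (- alpha) => beta be0 be1 be2.
pose C := beta / (48 * r * S).
have C0 : 0 < C by rewrite divr_gt0// !mulr_gt0.
split; last by exists (r / 4), C; split; [exact: divr_gt0|by []|move=> a c _ h;
  exact: lambda_tri_gap].
apply/nbhs_ballP; exists (r / 8); first exact: divr_gt0.
move=> [a c] [/=]; rewrite /ball/= => ha hc _ hne.
have hac : `|a| + `|c - r| < r / 4.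
  by move: ha hc; rewrite sub0r normrN (distrC r c); lra.
have hpos : 0 < a ^+ 2 + (c - r) ^+ 2.
  rewrite lt0r addr_ge0 ?sqr_ge0// andbT paddr_eq0 ?sqr_ge0// !sqrf_eq0 subr_eq0.
  by apply/negP => /andP[/eqP a0 /eqP cr]; apply: hne; rewrite a0 cr.
apply: le_lt_trans (lambda_tri_gap hS r0 Sr be0 be1 be2 hac) _.
have lf := lambda_tri_fin_num hS r0 Sr be0.
by rewrite lteBlDr// lteDl// lte_fin mulr_gt0.
Qed.
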